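(* For all integers $i,j\ge 1$, the number of pairs $(F,x)$ where $F$ is a fighting fish with $i$ free left lower edges and $j$ free right lower edges and $x$ is a tail of $F$, is $$\frac{2i+2j-3}{(2i-1)(2j-1)}\binom{2i+j-3}{j-1}\binom{2j+i-3}{i-1}.$$
   Context: A cell is a unit square rotated by 45 degrees; its four edges are called its left upper, left lower, right upper and right lower edges. Cells are glued edge to edge; an edge of a cell is free if it is not glued to an edge of another cell. A fighting fish is a collection of cells glued along edges that can be obtained from a single initial cell (the head) by repeatedly applying one of the following operations: (i) if a cell $a$ has a free right upper edge, glue the left lower edge of a new cell to it; (ii) if a cell $a$ has a free right lower edge, glue the left upper edge of a new cell to it; (iii) if cells $a,b,c$ are such that the left lower edge of $b$ is glued to the right upper edge of $a$, the left upper edge of $c$ is glued to the right lower edge of $a$, and the right lower edge of $b$ and the right upper edge of $c$ are free, glue simultaneously the left upper edge of a new cell $d$ to the right lower edge of $b$ and the left lower edge of $d$ to the right upper edge of $c$. A fighting fish is the resulting glued object, independent of the order of construction (cells need not fit in the plane). A tail of a fighting fish is the rightmost point of a cell whose two right edges are free (a final cell); the number of tails equals the number of final cells. *)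

(* Defs.v *)
From HB Require Import structures.
From mathcomp Require Import all_boot all_order all_algebra all_fingroup.
Set Implicit Arguments. Unset Strict Implicit. Unset Printing Implicit Defensive.

(* An abstract glued collection of n cells, labelled by 'I_n.
   S.1 = "right upper" gluing: S.1 a = Some b  iff the right upper edge of a
         is glued to the left lower edge of b (None: right upper edge of a free).
   S.2 = "right lower" gluing: S.2 a = Some b  iff the right lower edge of a
         is glued to the left upper edge of b (None: right lower edge of a free).
   These are the only kinds of gluing produced by operations (i)-(iii). *)
Definition fstruct (n : nat) :=
  ({ffun 'I_n -> option 'I_n} * {ffun 'I_n -> option 'I_n})%type.

Section Fish.
Variable n : nat.

Definition inj_opt (f : {ffun 'I_n -> option 'I_n}) : bool :=
  [forall x, forall y, forall z, (f x == Some z) && (f y == Some z) ==> (x == y)].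

Definition ll_glued (S : fstruct n) (x : 'I_n) : bool := [exists c, S.1 c == Some x].
Definition lu_glued (S : fstruct n) (x : 'I_n) : bool := [exists c, S.2 c == Some x].

(* S is obtained from the head (cell 0) by operations (i),(ii),(iii),
   cell k being the cell created at step k. *)
Definition ordered_constructible (S : fstruct n) : bool :=
  [&& 0 < n, inj_opt S.1, inj_opt S.2 &
  [forall k : 'I_n,
    if val k == 0 then ~~ ll_glued S k && ~~ lu_glued S k
    else [||
             [exists a : 'I_n, (a < k) && (S.1 a == Some k)] && ~~ lu_glued S k,
             [exists a : 'I_n, (a < k) && (S.2 a == Some k)] && ~~ ll_glued S k |
             [exists a : 'I_n, exists b : 'I_n, exists c : 'I_n,
               [&& a < k, b < k, c < k, S.1 a == Some b, S.2 a == Some c,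
                   S.2 b == Some k & S.1 c == Some k]]]]].

Definition relabel (s : {perm 'I_n}) (S : fstruct n) : fstruct n :=
  ([ffun y => omap s (S.1 ((s^-1)%g y))], [ffun y => omap s (S.2 ((s^-1)%g y))]).

Definition final_cell (S : fstruct n) (x : 'I_n) : bool :=
  (S.1 x == None) && (S.2 x == None).

Definition n_free_ll (S : fstruct n) : nat := #|[set x | ~~ ll_glued S x]|.
Definition n_free_rl (S : fstruct n) : nat := #|[set x | S.2 x == None]|.

Definition pair_class (p : fstruct n * 'I_n) : {set fstruct n * 'I_n} :=
  [set (relabel s p.1, s p.2) | s : {perm 'I_n}].

Definition fish_tail_classes (i j : nat) : {set {set fstruct n * 'I_n}} :=
  [set pair_class p | p in [set p : fstruct n * 'I_n |
     [&& ordered_constructible p.1, final_cell p.1 p.2,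
         n_free_ll p.1 == i & n_free_rl p.1 == j]]].

End Fish.

Definition fish_tail_count (n i j : nat) : nat := #|fish_tail_classes n i j|.

(* Main.v *)
Require Import Defs.
From HB Require Import structures.
From mathcomp Require Import all_boot all_order all_algebra all_fingroup.
From mathcomp Require Import ring zify.
From mathcomp Require boolp.
Set Implicit Arguments. Unset Strict Implicit. Unset Printing Implicit Defensive.
Import GRing.Theory Num.Theory.

(** Cut a fish into columns, a column being a stack of cells in which
    consecutive cells share the right corner of a common left neighbour.  The
    right boundary of a column splits into segments of m >= 1 cells, and a
    segment is followed by a column of m - 1 cells (one per glued pair of
    consecutive cells), plus one if a cell is glued to its top right upper
    edge, plus one if a cell is glued to its bottom right lower edge.  Weigh
    the last event by [a] (a free left lower edge) and its negation by [b] (a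
    free right lower edge), and let C_h be the series of the forests that grow
    from a column of h cells.  Then C(x) = sum_h C_h x^h satisfies C = 1 + C D
    with D_m = b C_(m-1) + (a + b) C_m + a C_(m+1) for m >= 1, and the series G
    of forests with a marked tail satisfies the linearized equation.

    Put al = a (1 + al) (1 + be)^2 and be = b (1 + be) (1 + al)^2.  The equation
    is solved by C = (1 + d) / ((1 + A d) (1 + B d)), where A = al / (1 + al),
    B = be / (1 + be) and d = be (1 + be) x (1 + d)^2, and the linearized one by
    G = b (1 + al) (1 + be) x C (1 + d) / (1 - d).  The series of fish with a
    marked tail is thus a G_1 = a b (1 + al) (1 + be), whose coefficients are
    explicit.  The columns are explored depth first; a labelled structure is
    determined up to relabelling by the word of answers given to this
    exploration, and these words are counted by C and G. *)

(** * Formal power series *)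

Section FormalPowerSeries.
Local Open Scope ring_scope.

Definition fps (R : Type) := nat -> R.

HB.instance Definition _ (R : Type) := boolp.gen_eqMixin (fps R).
HB.instance Definition _ (R : Type) := boolp.gen_choiceMixin (fps R).

Variable R : comNzRingType.
Implicit Types f g h : fps R.

Lemma fpsP f g : (forall n, f n = g n) -> f = g.
Proof. exact: boolp.functional_extensionality_dep. Qed.

Definition fps_add f g : fps R := fun n => f n + g n.
Definition fps_opp f : fps R := fun n => - f n.
Definition fps_const (c : R) : fps R := fun n => if n is 0%N then c else 0.
Definition fps_mul f g : fps R := fun n => \sum_(i < n.+1) f i * g (n - i)%N.

Fact fps_addA : associative fps_add.
Proof. by move=> f g h; apply: fpsP => n; apply: addrA. Qed.
Fact fps_addC : commutative fps_add.
Proof. by move=> f g; apply: fpsP => n; apply: addrC. Qed.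
Fact fps_add0 : left_id (fps_const 0) fps_add.
Proof. by move=> f; apply: fpsP => -[|n]; apply: add0r. Qed.
Fact fps_addN : left_inverse (fps_const 0) fps_opp fps_add.
Proof. by move=> f; apply: fpsP => -[|n]; apply: addNr. Qed.

HB.instance Definition _ :=
  GRing.isZmodule.Build (fps R) fps_addA fps_addC fps_add0 fps_addN.

(** Commutativity and associativity are inherited from polynomials: coefficient n of a product only
    sees the truncations of the factors at any order N > n. *)
Let trunc N f : {poly R} := \poly_(i < N) f i.

Let trunc_mul N f g n : (n < N)%N -> fps_mul f g n = (trunc N f * trunc N g)`_n.
Proof.
move=> ltnN; rewrite coefM; apply: eq_bigr => i _; rewrite !coef_poly.
by rewrite (leq_ltn_trans (leq_ord i) ltnN) (leq_ltn_trans (leq_subr _ _) ltnN).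
Qed.

Fact fps_mulC : commutative fps_mul.
Proof.
by move=> f g; apply: fpsP => n; rewrite !(@trunc_mul n.+1) // mulrC.
Qed.

Fact fps_mulA : associative fps_mul.
Proof.
move=> f g h; apply: fpsP => n.
have := congr1 (fun p : {poly R} => p`_n)
  (mulrA (trunc n.+1 f) (trunc n.+1 g) (trunc n.+1 h)).
rewrite coefM [in RHS]coefM => E; rewrite /fps_mul -/fps_mul.
transitivity (\sum_(i < n.+1)
   (trunc n.+1 f)`_i * (trunc n.+1 g * trunc n.+1 h)`_(n - i)).
  apply: eq_bigr => i _; rewrite coef_poly ltn_ord.
  by rewrite -trunc_mul ?ltnS ?leq_subr.
rewrite E; apply: eq_bigr => i _.
by rewrite [in X in _ * X]coef_poly ltnS leq_subr -trunc_mul.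
Qed.

Fact fps_mul1 : left_id (fps_const 1) fps_mul.
Proof.
move=> f; apply: fpsP => n; rewrite /fps_mul big_ord_recl /= mul1r subn0.
by rewrite big1 ?addr0 // => i _; rewrite mul0r.
Qed.

Fact fps_mulDl : left_distributive fps_mul fps_add.
Proof.
move=> f g h; apply: fpsP => n; rewrite /fps_mul /fps_add -big_split /=.
by apply: eq_bigr => i _; rewrite mulrDl.
Qed.

Fact fps_oner_neq0 : fps_const 1 != fps_const 0.
Proof.
apply/eqP => /(congr1 (fun f : fps R => f 0%N)) /eqP.
by rewrite /= oner_eq0.
Qed.

HB.instance Definition _ := GRing.Zmodule_isComNzRing.Build (fps R)
  fps_mulA fps_mulC fps_mul1 fps_mulDl fps_oner_neq0.

Lemma fps_addE f g n : (f + g) n = f n + g n. Proof. by []. Qed.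
Lemma fps_oppE f n : (- f) n = - f n. Proof. by []. Qed.
Lemma fps_0E n : (0 : fps R) n = 0. Proof. by case: n. Qed.
Lemma fps_1E n : (1 : fps R) n = (n == 0%N)%:R. Proof. by case: n. Qed.
Lemma fps_mulE f g n : (f * g) n = \sum_(i < n.+1) f i * g (n - i)%N.
Proof. by []. Qed.
Lemma fps_mul0E f g : (f * g) 0%N = f 0%N * g 0%N.
Proof. by rewrite fps_mulE big_ord1. Qed.

Fact fps_const_is_zmod_morphism : zmod_morphism fps_const.
Proof.
move=> c e; apply: fpsP => -[|n] //=.
by rewrite fps_addE fps_oppE /= subr0.
Qed.

Fact fps_const_is_monoid_morphism : monoid_morphism fps_const.
Proof.
split=> // c e; apply: fpsP => n; rewrite fps_mulE big_ord_recl /= subn0.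
rewrite big1 => [|i _]; last by rewrite mul0r.
by case: n => [|n] /=; rewrite ?mulr0 addr0.
Qed.

HB.instance Definition _ :=
  GRing.isZmodMorphism.Build R (fps R) fps_const fps_const_is_zmod_morphism.
HB.instance Definition _ :=
  GRing.isMonoidMorphism.Build R (fps R) fps_const fps_const_is_monoid_morphism.

Lemma fps_constME c f n : (fps_const c * f) n = c * f n.
Proof.
rewrite fps_mulE big_ord_recl /= subn0 big1 ?addr0 // => i _.
by rewrite mul0r.
Qed.

Definition fpsX : fps R := fun n => (n == 1%N)%:R.

Definition fps_shift f : fps R := fun n => f n.+1.

Lemma fpsXM0 f : (fpsX * f) 0%N = 0.
Proof. by rewrite fps_mul0E mul0r. Qed.

Lemma fpsXMS f n : (fpsX * f) n.+1 = f n.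
Proof.
rewrite fps_mulE big_ord_recl mul0r add0r big_ord_recl mul1r subn1 /=.
by rewrite big1 ?addr0 // => i _; rewrite mul0r.
Qed.

Lemma fps_shiftE f : f = fps_const (f 0%N) + fpsX * fps_shift f.
Proof.
apply: fpsP => -[|n]; rewrite fps_addE ?fpsXM0 ?addr0 //.
by rewrite fpsXMS /= add0r.
Qed.

Lemma fpsX_inj : injective ( *%R fpsX).
Proof.
move=> f g eq_fg; apply: fpsP => n.
by have := congr1 (fun h : fps R => h n.+1) eq_fg; rewrite !fpsXMS.
Qed.

End FormalPowerSeries.

(** * Fixed points and bivariate series *)

Section FixedPoint.
Local Open Scope ring_scope.

(** Banach's fixed point theorem, with agreement up to order n as distance: the iterates of [Phi]
    form a Cauchy sequence, whose limit is fixed since [Phi] gains one order. The abstract form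
    serves series in one variable as well as pairs of series in two. *)
Lemma contraction_fixpoint (T : Type) (agree : nat -> T -> T -> Prop)
    (Phi : T -> T) (f0 : T) :
    (forall n f g h, agree n f g -> agree n h g -> agree n f h) ->
    (forall f g, agree 0%N f g) ->
    (forall f g, (forall n, agree n f g) -> f = g) ->
    (forall u, (forall n, agree n (u n) (u n.+1)) ->
       exists l, forall n, agree n l (u n)) ->
    (forall n f g, agree n f g -> agree n.+1 (Phi f) (Phi g)) ->
  exists f, f = Phi f.
Proof.
move=> agreeT agree0 agreeI agreeC PhiC.
have [n|l lP] := agreeC (fun n => iter n Phi f0).
  by elim: n => [|n IHn] //=; apply: PhiC.
exists l; apply: agreeI => -[//|n].
exact: (agreeT _ _ _ _ (lP n.+1) (PhiC _ _ _ (lP n))).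
Qed.

Definition agree1 (R : Type) n (f g : fps R) :=
  forall i, (i < n)%N -> f i = g i.

Variable R : comNzRingType.
Implicit Types f g h : fps R.

Lemma agree1D n f g f' g' :
  agree1 n f g -> agree1 n f' g' -> agree1 n (f + f') (g + g').
Proof. by move=> E E' i ltin; rewrite !fps_addE E ?E'. Qed.

Lemma agree1M n f g f' g' :
  agree1 n f g -> agree1 n f' g' -> agree1 n (f * f') (g * g').
Proof.
move=> E E' i ltin; rewrite !fps_mulE; apply: eq_bigr => k _.
by rewrite E ?E' ?(leq_ltn_trans _ ltin) ?leq_subr // -ltnS.
Qed.

Lemma agree1XM n f g : agree1 n f g -> agree1 n.+1 (fpsX R * f) (fpsX R * g).
Proof. by move=> E [|i] ltin; rewrite ?fpsXM0 // !fpsXMS E. Qed.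

Lemma fps_fixpoint (c : fps R) (Psi : fps R -> fps R) :
    (forall n f g, agree1 n f g -> agree1 n (Psi f) (Psi g)) ->
  exists f, f = c + fpsX R * Psi f.
Proof.
move=> PsiC.
apply: (@contraction_fixpoint _ (@agree1 R) (fun f => c + fpsX R * Psi f) 0).
- by move=> n f g h E1 E2 i ltin; rewrite E1 // E2.
- by [].
- by move=> f g E; apply: fpsP => n; apply: (E n.+1).
- move=> u uE; exists (fun n => u n.+1 n) => n i ltin.
  elim: n ltin => // n IHn; rewrite ltnS leq_eqVlt => /predU1P[-> //|ltin].
  by rewrite IHn // uE.
- by move=> n f g E; apply: agree1D => //; apply/agree1XM/PsiC.
Qed.

(** Since f = 1 + x * [fps_shift f], the inverse is the fixed point of g = 1 - x * [fps_shift f] *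
    g. *)
Lemma fps_inverse f : f 0%N = 1 -> exists g, f * g = 1.
Proof.
move=> f0; have [n g h E|g gE] := @fps_fixpoint 1 (fun g => - fps_shift f * g).
  exact: agree1M.
by exists g; rewrite [f]fps_shiftE f0 rmorph1 mulrDl mul1r {1}gE; ring.
Qed.

End FixedPoint.

Section BivariateSeries.
Local Open Scope ring_scope.
Variable K : comNzRingType.

Definition bps := fps (fps K).
HB.instance Definition _ := GRing.ComNzRing.on bps.

Definition bpsX : bps := fpsX (fps K).
Definition bpsY : bps := fps_const (fpsX K).

Implicit Types f g h : bps.

Lemma bpsP f g : (forall i j, f i j = g i j) -> f = g.
Proof. by move=> E; apply: fpsP => i; apply: fpsP => j. Qed.

Lemma bps_addE f g i j : (f + g) i j = f i j + g i j.
Proof. by []. Qed.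

Lemma bps_mulE f g i j :
  (f * g) i j = \sum_(k < i.+1) \sum_(l < j.+1) f k l * g (i - k)%N (j - l)%N.
Proof.
rewrite fps_mulE; elim/big_rec2: _ => [|k u v _ IH]; first exact: fps_0E.
by rewrite fps_addE IH fps_mulE.
Qed.

Lemma bps_1E i j : (1 : bps) i j = ((i == 0%N) && (j == 0%N))%:R.
Proof.
rewrite fps_1E; case: i => [|i]; last by rewrite mulr0n fps_0E.
by rewrite mulr1n fps_1E.
Qed.

Lemma bpsXM f i j : (bpsX * f) i j = if i is i'.+1 then f i' j else 0.
Proof. by case: i => [|i]; rewrite ?fpsXM0 ?fps_0E ?fpsXMS. Qed.

Lemma bpsYM f i j : (bpsY * f) i j = if j is j'.+1 then f i j' else 0.
Proof. by case: j => [|j]; rewrite fps_constME ?fpsXM0 ?fpsXMS. Qed.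

(** Agreement in total degree, so that multiplication by either variable gains one order. *)
Definition agree2 n f g := forall i j, (i + j < n)%N -> f i j = g i j.

Lemma agree2D n f g f' g' :
  agree2 n f g -> agree2 n f' g' -> agree2 n (f + f') (g + g').
Proof. by move=> E E' i j ltn; rewrite !bps_addE E ?E'. Qed.

Lemma agree2M n f g f' g' :
  agree2 n f g -> agree2 n f' g' -> agree2 n (f * f') (g * g').
Proof.
move=> E E' i j ltn; rewrite !bps_mulE.
apply: eq_bigr => k _; apply: eq_bigr => l _.
by rewrite E ?E' // (leq_ltn_trans _ ltn) // leq_add ?leq_subr // -ltnS.
Qed.

Lemma agree2XM n f g : agree2 n f g -> agree2 n.+1 (bpsX * f) (bpsX * g).
Proof. by move=> E [|i] j ltn; rewrite !bpsXM // E. Qed.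

Lemma agree2YM n f g : agree2 n f g -> agree2 n.+1 (bpsY * f) (bpsY * g).
Proof.
by move=> E i [|j]; rewrite !bpsYM // addnS => ltn; rewrite E.
Qed.

Lemma bps_system :
  exists al be : bps, al = bpsX * (1 + al) * (1 + be) ^+ 2 /\
                      be = bpsY * (1 + be) * (1 + al) ^+ 2.
Proof.
pose agree n (u v : bps * bps) := agree2 n u.1 v.1 /\ agree2 n u.2 v.2.
pose Phi (u : bps * bps) := (bpsX * ((1 + u.1) * (1 + u.2) ^+ 2),
                             bpsY * ((1 + u.2) * (1 + u.1) ^+ 2)).
have [| | | | |[al be] E] := @contraction_fixpoint _ agree Phi (0, 0).
- move=> n u v w [E1 E2] [E3 E4].
  by split=> i j ltn; rewrite ?E1 ?E2 ?E3 ?E4.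
- by [].
- move=> [f f'] [g g'] E.
  congr pair; apply: bpsP => i j; have [E1 E2] := E (i + j).+1.
    exact: E1.
  exact: E2.
(* The coefficient at (i, j) no longer changes from iterate i + j + 1 on. *)
- move=> u uE; exists (fun i j => (u (i + j).+1).1 i j,
                       fun i j => (u (i + j).+1).2 i j) => n.
  suff E i j : (i + j < n)%N ->
    (u (i + j).+1).1 i j = (u n).1 i j /\ (u (i + j).+1).2 i j = (u n).2 i j.
    by split=> i j ltn /=; have [] := E i j ltn.
  elim: n => // n IHn; rewrite ltnS leq_eqVlt => /predU1P[-> //|ltn].
  have [-> ->] := IHn ltn; have [E1 E2] := uE n.
  by rewrite E1 ?E2.
- move=> n [f f'] [g g'] /= [E E'].
  have agree1C : agree2 n 1 1 by [].
  split; [apply: agree2XM | apply: agree2YM]; rewrite ?expr2 /=;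
    by do ?[apply: agree2M | apply: agree2D].
by exists al, be; split; [rewrite {1}[al](congr1 fst E) | rewrite {1}[be](congr1 snd E)]; rewrite /= mulrA.
Qed.

End BivariateSeries.

(** * The column equations *)

Section ColumnEquation.
Local Open Scope ring_scope.
Variable P : comNzRingType.

(* The series of a segment of [m + 1] cells, when a column of h cells counts for
   [f h]. *)
Definition closing_weight (a b : P) (f : nat -> P) m :=
  a * f m.+1 + b * f m + a * f m.+2 + b * f m.+1.

(** As series in x, the recurrences read C = 1 + x D(C) C and G = x ((D(G) + b) C + D(C) G), where
    D(f) has the coefficients [closing_weight a b f m]. The closed forms are checked, not derived:
    with denominators cleared, both equations reduce to the quadratic equation of d. The extra b at
    m = 0 stands for a segment of one cell with both right edges free, which carries a tail. *)
Lemma column_equations_solution (a b al be : P) :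
  al = a * (1 + al) * (1 + be) ^+ 2 -> be = b * (1 + be) * (1 + al) ^+ 2 ->
  exists C G : nat -> P,
    [/\ C 0%N = 1, G 0%N = 0, G 1%N = b * ((1 + al) * (1 + be)),
        forall n, C n.+1 =
          \sum_(m < n.+1) closing_weight a b C m * C (n - m)%N
      & forall n, G n.+1 = \sum_(m < n.+1)
          ((closing_weight a b G m + b * (val m == 0%N)%:R) * C (n - m)%N
           + closing_weight a b C m * G (n - m)%N)].
Proof.
move=> alE beE.
(* [A] and [B] are al / (1 + al) and be / (1 + be), written without division. *)
pose A := a * (1 + be) ^+ 2; pose B := b * (1 + al) ^+ 2.
pose ga := be * (1 + be); pose S := (1 + al) * (1 + be).
have iA : (1 + al) * (1 - A) = 1.
  by transitivity (1 + al - a * (1 + al) * (1 + be) ^+ 2);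
    [rewrite /A; ring | rewrite -alE addrK].
have iB : (1 + be) * (1 - B) = 1.
  by transitivity (1 + be - b * (1 + be) * (1 + al) ^+ 2);
    [rewrite /B; ring | rewrite -beE addrK].
have aE : a = A * (1 - B) ^+ 2.
  by transitivity (a * ((1 + be) * (1 - B)) ^+ 2); [rewrite iB | rewrite /A];
    ring.
have bE : b = B * (1 - A) ^+ 2.
  by transitivity (b * ((1 + al) * (1 - A)) ^+ 2); [rewrite iA | rewrite /B];
    ring.
have iS : S * ((1 - A) * (1 - B)) = 1.
  by transitivity (((1 + al) * (1 - A)) * ((1 + be) * (1 - B)));
    [rewrite /S; ring | rewrite iA iB mulr1].
have gaE : (1 - B) ^+ 2 * ga = B.
  transitivity (((1 + be) * (1 - B)) * (((1 + be) * (1 - B)) - (1 - B))).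
    by rewrite /ga; ring.
  by rewrite iB; ring.
pose x := fpsX P; pose c := @fps_const P.
have [n f g E|d] := @fps_fixpoint P 0 (fun d => c ga * (1 + d) ^+ 2).
  by rewrite !expr2; do ?[apply: agree1M | apply: agree1D].
rewrite add0r -/x => dE.
have d0 : d 0%N = 0 by rewrite dE fpsXM0.
(* The closed form of C is [w] / [u]. *)
pose w := 1 + d; pose u := (1 + c A * d) * (1 + c B * d).
have u0 : u 0%N = 1.
  by rewrite /u fps_mul0E !fps_addE !fps_mul0E d0 !mulr0 addr0 mulr1.
have [iu uiu] := fps_inverse u0.
have [|v vE] := @fps_inverse P (1 - d).
  by rewrite fps_addE fps_oppE d0 subr0.
have d1 : d 1%N = ga.
  by rewrite dE fpsXMS fps_constME expr2 fps_mul0E fps_addE d0 addr0 !mulr1.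
pose C := w * iu.
have Cu : C * u = w by rewrite /C; ring: uiu.
have C0 : C 0%N = 1.
  have := congr1 (fun f : fps P => f 0%N) Cu.
  by rewrite fps_mul0E u0 mulr1 => ->; rewrite /w fps_addE d0 addr0.
(* The double shift in D leaves C_1 as a boundary term, so its value is needed. *)
have C1 : C 1%N = ga * (1 - A - B).
  have := congr1 (fun f : fps P => f 1%N) Cu.
  rewrite fps_mulE !big_ord_recl big_ord0 /= C0 u0 /w fps_addE d1 add0r.
  rewrite /u fps_mulE !big_ord_recl big_ord0 /= !fps_addE !fps_constME.
  rewrite /bump /= !d0 d1 -[(1 : fps P) 1%N]/0 -[(1 : fps P) 0%N]/1 => E.
  by transitivity (ga - (A + B) * ga); [rewrite -{1}E |]; ring.
have caE : c a = c A * (1 - c B) ^+ 2.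
  by rewrite -(rmorph1 c) -rmorphB -rmorphXn -rmorphM -aE.
have cbE : c b = c B * (1 - c A) ^+ 2.
  by rewrite -(rmorph1 c) -rmorphB -rmorphXn -rmorphM -bE.
have cSE : c S * ((1 - c A) * (1 - c B)) = 1.
  by rewrite -(rmorph1 c) -!rmorphB -!rmorphM iS.
have cac : c a * c (C 1%N) = c A * c B * (1 - c A - c B).
  rewrite -(rmorph1 c) -!rmorphB -!rmorphM C1; congr (c _).
  by rewrite aE -{3}gaE; ring.
(* The quadratic equation of d with [ga] eliminated; [N1] and [N2] are multiples of the difference
   of its sides. *)
have rel : c B * x * w ^+ 2 = (1 - c B) ^+ 2 * d.
  have cgaE : c B = (1 - c B) ^+ 2 * c ga.
    by rewrite -(rmorph1 c) -rmorphB -rmorphXn -rmorphM gaE.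
  by rewrite [in RHS]dE -/w [in LHS]cgaE; ring.
(* The left side is - u^2 times x (C - 1 - x D(C) C), the defect of the equation of C; [N2] plays
   the same part for G. *)
have N1 : (1 + x) * (c a + c b * x) * w ^+ 2
     - (x * (1 + c a + c b + c a * c (C 1%N)) + c a) * w * u + x * u ^+ 2 = 0.
  transitivity
    (((1 - c B) ^+ 2 * d - c B * x * w ^+ 2)
     * (c A * w * (1 - c A - c B - c A * c B * d) - (1 - c A) ^+ 2 * x)).
    by rewrite cac caE cbE /u /w; ring.
  by rewrite rel subrr mul0r.
have N2 : (1 + x) * (c a + c b * x) * w ^+ 2
     + (x * ((1 - c A) * (1 - c B)) - c a) * u * (1 - d) - x * u ^+ 2 = 0.
  transitivity
    (((1 - c B) ^+ 2 * d - c B * x * w ^+ 2)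
     * (c A * (3%:R - (c A + c B) + (1 - c A * c B + (c A + c B)) * d
               + c A * c B * d ^+ 2) - (1 - c A) ^+ 2 * x)).
    by rewrite caE cbE /u /w; ring.
  by rewrite rel subrr mul0r.
pose D f : fps P := c a * fps_shift f + c b * f
  + c a * fps_shift (fps_shift f) + c b * fps_shift f.
have DE f n : D f n = closing_weight a b f n.
  by rewrite /D !fps_addE !fps_constME.
(* Multiplication by x^2 undoes the shifts and leaves f_0 and f_1 as boundary terms. *)
have xD f : x ^+ 2 * D f = (1 + x) * (c a + c b * x) * f
    - ((c a + c b) * x + c a) * c (f 0%N) - c a * x * c (f 1%N).
  have e1 : f = c (f 0%N) + x * fps_shift f := fps_shiftE f.
  have e2 : fps_shift f = c (f 1%N) + x * fps_shift (fps_shift f).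
    exact: fps_shiftE.
  by rewrite /D; ring: e1 e2.
have CE : C = 1 + x * D C * C.
  apply: fpsX_inj; rewrite -/x; apply/eqP; rewrite -subr_eq0; apply/eqP.
  transitivity (- iu ^+ 2 * ((1 + x) * (c a + c b * x) * w ^+ 2
     - (x * (1 + c a + c b + c a * c (C 1%N)) + c a) * w * u + x * u ^+ 2)).
    transitivity (x * (C - 1) - (x ^+ 2 * D C) * C); first by ring.
    by rewrite xD C0 (_ : c 1 = 1) // /C; ring: uiu.
  by rewrite N1 mulr0.
pose G := c b * c S * x * C * w * v.
have G0 : G 0%N = 0.
  by rewrite /G !fps_mul0E /x /= /fpsX /= !(mulr0, mul0r).
have G1 : G 1%N = b * S.
  have -> : G = c b * (c S * (x * (C * w * v))) by rewrite /G; ring.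
  rewrite !fps_constME fpsXMS !fps_mul0E C0 /w fps_addE d0.
  have := congr1 (fun f : fps P => f 0%N) vE.
  by rewrite fps_mul0E !fps_addE fps_oppE d0 subr0 addr0 !fps_1E !mul1r => ->; rewrite !mulr1.
have cM : c (b * S) = c b * c S by apply: rmorphM.
set t := (1 - c A) * (1 - c B) in cSE N2.
(* The linear equation solved for G, as 1 - x D(C) is the inverse of C. *)
have GE : G = x * (D G + c b) * C ^+ 2.
  apply: fpsX_inj; rewrite -/x; apply/eqP; rewrite -subr_eq0; apply/eqP.
  transitivity (- c b * x * w ^+ 2 * iu ^+ 3 * v * c S *
     ((1 + x) * (c a + c b * x) * w ^+ 2
     + (x * t - c a) * u * (1 - d) - x * u ^+ 2)).
    transitivity (x * G - (x ^+ 2 * D G + x ^+ 2 * c b) * C ^+ 2); first by ring.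
    rewrite xD G0 (_ : c 0 = 0) // G1 cM.
    have dv : d * v = v - 1 by rewrite -vE; ring.
    by rewrite /G /C; ring: uiu dv cSE.
  by rewrite N2 mulr0.
exists C, G; split=> // n.
  by rewrite {1}CE fps_addE add0r -mulrA fpsXMS fps_mulE;
    under eq_bigr do rewrite DE.
have {1}-> : G = x * ((D G + c b) * C + D C * G).
  have iC : C * (1 - x * D C) = 1 by rewrite mulrBr mulr1 {1}CE; ring.
  have E : G * (1 - x * D C) = x * (D G + c b) * C.
    by rewrite {1}GE; transitivity (x * (D G + c b) * C * (C * (1 - x * D C)));
      [ring | rewrite iC mulr1].
  by transitivity (G * (1 - x * D C) + x * D C * G); [ring | rewrite E; ring].
rewrite fpsXMS fps_addE !fps_mulE -big_split; apply: eq_bigr => m _ /=.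
rewrite fps_addE !DE; congr ((_ + _) * _ + _).
by case: (val m) => [|k]; rewrite /c ?mulr1 ?mulr0.
Qed.
End ColumnEquation.

(** * Coefficients *)

Section GoodLagrange.
Local Open Scope ring_scope.

(* The coefficient of a^n b^m in (1 + al)^(r+1) (1 + be)^(q+1). *)
Definition good_coef (r q n m : nat) : rat :=
  'C(n + r + 2 * m, n)%:R * 'C(2 * n + q + m, m)%:R
  * (2 * r.+1%:R * n%:R + r.+1%:R * q.+1%:R + 2 * q.+1%:R * m%:R)
  / ((r.+1%:R + 2 * m%:R) * (2 * n%:R + q.+1%:R)).

Lemma binS_rat n k : ('C(n.+1, k.+1))%:R = n.+1%:R / k.+1%:R * 'C(n, k)%:R :> rat.
Proof.
apply: (@mulfI _ k.+1%:R); first by rewrite pnatr_eq0.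
by rewrite -natrM -mul_bin_diag natrM; field; rewrite nat1r pnatr_eq0.
Qed.

Lemma bin_right_rat n k :
  'C(n + k, k.+1)%:R = n%:R / k.+1%:R * 'C(n + k, k)%:R :> rat.
Proof.
apply: (@mulfI _ k.+1%:R); first by rewrite pnatr_eq0.
by rewrite -natrM mul_bin_left addnK natrM; field; rewrite nat1r pnatr_eq0.
Qed.

(** Mirrors (1 + al)^(r+2) (1 + be)^(q+1) = (1 + al)^(r+1) (1 + be)^(q+1) + a (1 + al)^(r+2) (1 +
    be)^(q+3). Expressing all binomials through two of them leaves an identity of rational
    functions. *)
Lemma good_coefSl r q n m : good_coef r.+1 q n m =
  good_coef r q n m + (if n is n'.+1 then good_coef r.+1 q.+2 n' m else 0).
Proof.
rewrite /good_coef; case: n => [|n].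
  rewrite !bin0 addr0 muln0 !add0n -!natr1.
  field; rewrite ?natr1 -?natrM -?natrD ?pnatr_eq0; lia.
rewrite (_ : n.+1 + r.+1 + 2 * m = (n + r.+1 + 2 * m).+1)%N; last by lia.
rewrite binS_rat.
rewrite (_ : n.+1 + r + 2 * m = (r.+1 + 2 * m) + n)%N; last by lia.
rewrite bin_right_rat (_ : r.+1 + 2 * m + n = n + r.+1 + 2 * m)%N; last by lia.
rewrite (_ : 2 * n.+1 + q + m = 2 * n + q.+2 + m)%N; last by lia.
move: ('C(_, _)%:R) ('C(_, _)%:R) => x y.
rewrite -[(n + r.+1 + 2 * m).+1%:R]natr1 !(natrD _ _ (2 * m)%N) natrM natrD -!natr1.
field; rewrite ?natr1 -?natrM -?natrD ?pnatr_eq0; lia.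
Qed.

Lemma good_coefC r q n m : good_coef r q n m = good_coef q r m n.
Proof.
rewrite /good_coef (_ : m + q + 2 * n = 2 * n + q + m)%N; last by lia.
rewrite (_ : 2 * m + r + n = n + r + 2 * m)%N; last by lia.
by congr (_ / _); ring.
Qed.

Lemma good_coefSr r q n m : good_coef r q.+1 n m =
  good_coef r q n m + (if m is m'.+1 then good_coef r.+2 q.+1 n m' else 0).
Proof.
rewrite good_coefC good_coefSl (good_coefC q).
by case: m => // m; rewrite (good_coefC q.+1).
Qed.

(** Mirrors (1 + al) (1 + be) = 1 + a (1 + al) (1 + be)^3 + b (1 + al)^2 (1 + be). *)
Lemma good_coef00 n m : good_coef 0 0 n m = ((n == 0%N) && (m == 0%N))%:R
  + (if n is n'.+1 then good_coef 0 2 n' m else 0)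
  + (if m is m'.+1 then good_coef 1 0 n m' else 0).
Proof.
case: n m => [|n] [|m].
- by rewrite /good_coef !bin0 /=; field.
- rewrite ?add0r ?addr0 /good_coef !bin0 !muln0 !add0n !binn -!natr1.
  by field; rewrite ?natr1 -?natrM ?nat1r -?natrD ?pnatr_eq0; lia.
- rewrite ?add0r ?addr0 /good_coef !bin0 !muln0 !addn0 !binn -!natr1.
  by field; rewrite ?natr1 -?natrM ?nat1r -?natrD ?pnatr_eq0; lia.
rewrite add0r /good_coef.
rewrite (_ : n.+1 + 0 + 2 * m.+1 = (n + 2 * m.+1).+1)%N; last by lia.
rewrite (_ : 2 * n.+1 + 0 + m.+1 = (2 * n.+1 + m).+1)%N; last by lia.
rewrite (_ : 2 * n + 2 + m.+1 = (2 * n.+1 + m).+1)%N; last by lia.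
rewrite (_ : n.+1 + 1 + 2 * m = 2 * m.+1 + n)%N; last by lia.
rewrite bin_right_rat (addnC (2 * m.+1)%N n) !binS_rat (addn0 n) (addn0 (2 * n.+1)%N).
move: ('C(_, _)%:R) ('C(_, _)%:R) => x y.
rewrite -[(n + 2 * m.+1).+1%:R]natr1 -[(2 * n.+1 + m).+1%:R]natr1.
rewrite !(natrD _ _ (2 * m.+1)%N) (natrD _ (2 * n.+1)%N) !natrM.
rewrite -[n.+1%:R]natr1 -[m.+1%:R]natr1.
field; rewrite ?natr1 -?natrM ?nat1r ?natr1 -?natrD ?pnatr_eq0; lia.
Qed.

Variables (al be : bps rat).
Hypothesis alE : al = bpsX _ * (1 + al) * (1 + be) ^+ 2.
Hypothesis beE : be = bpsY _ * (1 + be) * (1 + al) ^+ 2.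

Let M r q : bps rat := (1 + al) ^+ r.+1 * (1 + be) ^+ q.+1.

(* The series [M r q] satisfy linear recurrences with a unique solution, so it is
   enough that [good_coef] satisfies them: no inversion formula is needed. *)
Lemma good_lagrange r q n m :
  ((1 + al) ^+ r.+1 * (1 + be) ^+ q.+1) n m = good_coef r q n m.
Proof.
have M00 : M 0 0 = 1 + bpsX _ * M 0 2 + bpsY _ * M 1 0.
  rewrite /M; transitivity (1 + al * (1 + be) + be); first by ring.
  by rewrite {2}beE {1}alE; ring.
have MSl r' q' : M r'.+1 q' = M r' q' + bpsX _ * M r'.+1 q'.+2.
  rewrite /M; transitivity (M r' q' + al * M r' q'); rewrite /M.
    by rewrite exprS; ring.
  by rewrite {2}alE !exprS; ring.
have MSr r' q' : M r' q'.+1 = M r' q' + bpsY _ * M r'.+2 q'.+1.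
  rewrite /M; transitivity (M r' q' + be * M r' q'); rewrite /M.
    by rewrite !exprS; ring.
  by rewrite {2}beE !exprS; ring.
(* Induction on the total degree, then r, then q: a term whose exponents grow carries a factor a or
   b and so has its coefficient taken in lower degree. *)
rewrite -/(M r q); have [N] := ubnP (n + m); elim: N r q n m => // N IHN.
elim=> [|r IHr] q n m ltN.
  elim: q n m ltN => [|q IHq] n m ltN.
    rewrite M00 !bps_addE bps_1E bpsXM bpsYM good_coef00.
    by case: n m ltN => [|n] [|m] ltN; rewrite ?IHN //; lia.
  rewrite MSr bps_addE bpsYM good_coefSr IHq //.
  by case: m ltN => // m ltN; rewrite IHN //; lia.
rewrite MSl bps_addE bpsXM good_coefSl IHr //.
by case: n ltN => // n ltN; rewrite IHN //; lia.
Qed.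
End GoodLagrange.

(** * Exploring a structure column by column *)

(* The columns to be explored are listed from top to bottom.  In
   [Busy out x xs stk], the current column has been settled down to the right
   upper edge of [x], and [out] is the column created so far on the right of the
   current segment; the next edge to be settled is the right lower edge of [x]. *)
Inductive state (T : Type) :=
  | Idle of seq (seq T)
  | Busy of seq T & T & seq T & seq (seq T).
Arguments Idle {T}.
Arguments Busy {T}.

(* [None] leaves the edge free and [Some (b, z)] glues a new cell [z] to it;
   [b = false] means that [z] is also glued to the right upper edge of the next
   cell of the column (operation (iii)), so that the segment goes on. *)
Definition move (T : Type) := option (bool * T).

Section Machine.
Variable T : Type.
Implicit Types (c : move T) (st : state T) (t : seq (move T)).

(** When a segment ends, [out] becomes a column placed above the remainder [xs] of the current one.
    Dropping an empty column also takes a letter. *)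
Definition upd c st : state T :=
  match st with
  | Idle [::] => st
  | Idle ([::] :: stk) => Idle stk
  | Idle ((x :: xs) :: stk) => Busy (if c is Some (_, z) then [:: z] else [::]) x xs stk
  | Busy out x xs stk =>
      match c, xs with
      | None, _ => Idle (out :: xs :: stk)
      | Some (false, z), y :: ys => Busy (rcons out z) y ys stk
      | Some (_, z), _ => Idle (rcons out z :: xs :: stk)
      end
  end.

(** Where operation (iii) is impossible the flag is forced to be [true], so that a structure cannot
    be described by two different words. *)
Definition enabled c st : bool :=
  match st, c with
  | Idle [::], _ => false
  | Idle ([::] :: _), None => true
  | Idle ([::] :: _), Some _ => false
  | Idle ((_ :: _) :: _), Some (b, _) => b
  | Busy _ _ [::] _, Some (b, _) => b
  | _, _ => true
  end.

Definition final st : bool := if st is Idle [::] then true else false.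

Definition run st t : state T := foldl (fun st c => upd c st) st t.

Fixpoint valid st t : bool :=
  if t is c :: t' then enabled c st && valid (upd c st) t' else true.

Definition complete st t : bool := valid st t && final (run st t).

Fixpoint log (A : Type) (f : move T -> state T -> seq A) st t : seq A :=
  if t is c :: t' then f c st ++ log f (upd c st) t' else [::].

(* A new cell with the cells glued to its left lower and left upper edges. *)
Definition emit c st : seq (T * (option T * option T)) :=
  match c, st with
  | Some (b, z), Busy _ x xs _ =>
      [:: (z, (if b then None else ohead xs, Some x))]
  | Some (_, z), Idle ((x :: _) :: _) => [:: (z, (Some x, None))]
  | _, _ => [::]
  end.

Definition open_left c st := [seq e <- emit c st | ~~ isSome e.2.1].

Definition skip1 c st : seq T :=
  match c, st with None, Idle ((x :: _) :: _) => [:: x] | _, _ => [::] end.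

Definition skip2 c st : seq T :=
  match c, st with None, Busy _ x _ _ => [:: x] | _, _ => [::] end.

(** Along a run, [out] is empty only if the right upper edge of x has been left free; if the right
    lower edge is left free too, x is a final cell. *)
Definition tail_cell c st : seq T :=
  match c, st with None, Busy [::] x _ _ => [:: x] | _, _ => [::] end.

(** Known cells whose right upper edge (right lower edge for [pend2]) is still to be settled; in a
    busy state the two lists differ by the current cell. *)
Definition pend1 st : seq T :=
  match st with
  | Idle stk => flatten stk
  | Busy out _ xs stk => out ++ xs ++ flatten stk
  end.

Definition pend2 st : seq T :=
  match st with
  | Idle stk => flatten stk
  | Busy out x xs stk => out ++ x :: xs ++ flatten stk
  end.

Definition stack_size st : nat :=
  match st with Idle stk => size stk | Busy _ _ _ stk => size stk end.

Definition new_cells t : seq T := pmap (omap snd) t.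

Definition used1 c st := pmap (fun e => e.2.1) (emit c st).
Definition used2 c st := pmap (fun e => e.2.2) (emit c st).

Lemma pmap_log A B (f : A -> option B) (g : move T -> state T -> seq A) st t :
  pmap f (log g st t) = log (fun c st => pmap f (g c st)) st t.
Proof. by elim: t st => //= c t IHt st; rewrite pmap_cat IHt. Qed.

Lemma filter_log A (p : pred A) (g : move T -> state T -> seq A) st t :
  filter p (log g st t) = log (fun c st => filter p (g c st)) st t.
Proof. by elim: t st => //= c t IHt st; rewrite filter_cat IHt. Qed.

Lemma emit_new st t : valid st t -> map fst (log emit st t) = new_cells t.
Proof.
elim: t st => //= c t IHt st /andP[en /IHt E]; rewrite map_cat E.
by case: st c en {E} => [[|[|x xs] stk]|out x [|y ys] stk] [[[] z]|].
Qed.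

(** A letter either drops an empty column or settles an edge, and the latter adds at most two
    columns to the stack; hence the factor 3. This bounds the length of a trace by the number of
    cells. *)
Lemma size_log_stack st t : valid st t ->
  size t + stack_size (run st t) <=
    3 * (size (log used1 st t) + size (log skip1 st t)
         + (size (log used2 st t) + size (log skip2 st t))) + stack_size st.
Proof.
elim: t st => [|c t IHt] st /=; first by lia.
case/andP=> en /IHt; rewrite !size_cat -/(run _ _).
have : (stack_size (upd c st)).+1 <= 3 * (size (used1 c st) + size (skip1 c st)
    + (size (used2 c st) + size (skip2 c st))) + stack_size st.
  case: st c en => [[|[|x xs] stk]|out x [|y ys] stk] [[[] z]|] //= _;
  by rewrite /used1 /used2 /=; lia.
by lia.
Qed.

End Machine.

(** * Naturality of the exploration in the labels *)

Section Naturality.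
Variables (T T' : Type) (s : T -> T').

Definition map_state st : state T' :=
  match st with
  | Idle stk => Idle (map (map s) stk)
  | Busy out x xs stk => Busy (map s out) (s x) (map s xs) (map (map s) stk)
  end.
Definition map_move (c : move T) : move T' := omap (fun bz => (bz.1, s bz.2)) c.
Definition map_glue (e : T * (option T * option T)) :=
  (s e.1, (omap s e.2.1, omap s e.2.2)).

Lemma map_upd c st : map_state (upd c st) = upd (map_move c) (map_state st).
Proof.
by case: st c => [[|[|x xs] stk]|out x [|y ys] stk] [[[] z]|] //=;
  rewrite map_rcons.
Qed.

Lemma map_enabled c st : enabled (map_move c) (map_state st) = enabled c st.
Proof. by case: st c => [[|[|x xs] stk]|out x [|y ys] stk] [[[] z]|]. Qed.

Lemma map_emit c st : emit (map_move c) (map_state st) = map map_glue (emit c st).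
Proof. by case: st c => [[|[|x xs] stk]|out x [|y ys] stk] [[[] z]|]. Qed.

Lemma map_open_left c st :
  open_left (map_move c) (map_state st) = map map_glue (open_left c st).
Proof. by case: st c => [[|[|x xs] stk]|out x [|y ys] stk] [[[] z]|]. Qed.

Lemma map_skip1 c st : skip1 (map_move c) (map_state st) = map s (skip1 c st).
Proof. by case: st c => [[|[|x xs] stk]|out x [|y ys] stk] [[[] z]|]. Qed.

Lemma map_skip2 c st : skip2 (map_move c) (map_state st) = map s (skip2 c st).
Proof. by case: st c => [[|[|x xs] stk]|out x [|y ys] stk] [[[] z]|]. Qed.

Lemma map_tail_cell c st : tail_cell (map_move c) (map_state st) = map s (tail_cell c st).
Proof. by case: st c => [[|[|x xs] stk]|[|o out] x [|y ys] stk] [[[] z]|]. Qed.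

Lemma map_valid st t : valid (map_state st) (map map_move t) = valid st t.
Proof. by elim: t st => //= c t IHt st; rewrite map_enabled -map_upd IHt. Qed.

Lemma map_run st t : run (map_state st) (map map_move t) = map_state (run st t).
Proof. by elim: t st => //= c t IHt st; rewrite -map_upd IHt. Qed.

Lemma map_final st : final (map_state st) = final st.
Proof. by case: st => [[|[|x xs] stk]|out x xs stk]. Qed.

Lemma map_complete st t : complete (map_state st) (map map_move t) = complete st t.
Proof. by rewrite /complete map_valid map_run map_final. Qed.

(** The machine never compares labels, so [s] need not be injective: this serves both permutations
    of the cells and the collapse of all labels to [tt]. *)
Lemma map_log_natural A A' (g : A -> A') f f' :
    (forall c st, f' (map_move c) (map_state st) = map g (f c st)) ->
  forall st t, log f' (map_state st) (map map_move t) = map g (log f st t).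
Proof.
move=> fE st t; elim: t st => //= c t IHt st.
by rewrite map_cat fE -map_upd IHt.
Qed.

Lemma map_new_cells t : new_cells (map map_move t) = map s (new_cells t).
Proof. by elim: t => //= -[[b z]|] t IHt //=; rewrite IHt. Qed.

End Naturality.

(** * Splitting a trace into a word and a list of cells *)

Section Labelling.
Variable T : Type.

Fixpoint label (w : seq (option bool)) (zs : seq T) : seq (move T) :=
  match w, zs with
  | None :: w', _ => None :: label w' zs
  | Some b :: w', z :: zs' => Some (b, z) :: label w' zs'
  | _, _ => [::]
  end.

Definition word (t : seq (move T)) : seq (option bool) := map (omap fst) t.

Lemma label_word t : label (word t) (new_cells t) = t.
Proof. by elim: t => //= -[[b z]|] t IHt //=; rewrite IHt. Qed.

Lemma word_label w zs : size zs = count isSome w -> word (label w zs) = w.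
Proof.
by elim: w zs => [|[b|] w IHw] [|z zs] //= => [[Ew]|Ew|Ew]; rewrite IHw.
Qed.

Lemma new_label w zs : size zs = count isSome w -> new_cells (label w zs) = zs.
Proof.
by elim: w zs => [|[b|] w IHw] [|z zs] //= => [[Ew]|Ew|Ew]; rewrite IHw.
Qed.

Lemma count_word t : count isSome (word t) = size (new_cells t).
Proof. by elim: t => //= -[[b z]|] t IHt //=; rewrite IHt. Qed.

End Labelling.

Lemma map_label T T' (s : T -> T') w zs :
  map (map_move s) (label w zs) = label w (map s zs).
Proof.
by elim: w zs => [|[b|] w IHw] zs //=; [case: zs => //= z zs|]; rewrite IHw.
Qed.

Lemma word_map T T' (s : T -> T') t : word (map (map_move s) t) = word t.
Proof. by rewrite /word -map_comp; apply: eq_map => -[[b z]|]. Qed.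

(** * Each right edge is settled exactly once *)

Section Accounting.
Variable T : eqType.
Implicit Types (c : move T) (st : state T) (t : seq (move T)).

(** A conservation law: a letter turns at most one pending cell into a used or skipped one, and
    makes the new cell, if any, pending. *)
Lemma perm_step1 c st : enabled c st ->
  perm_eq (used1 c st ++ skip1 c st ++ pend1 (upd c st))
          (pend1 st ++ new_cells [:: c]).
Proof.
move=> en; apply/seq.permP => p; move: en.
case: st c => [[|[|x xs] stk]|out x [|y ys] stk] [[[] z]|] //= _;
  rewrite /used1 /= -?cats1 ?count_cat /= ?count_cat /= ?count_cat /=; lia.
Qed.

Lemma perm_step2 c st : enabled c st ->
  perm_eq (used2 c st ++ skip2 c st ++ pend2 (upd c st))
          (pend2 st ++ new_cells [:: c]).
Proof.
move=> en; apply/seq.permP => p; move: en.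
case: st c => [[|[|x xs] stk]|out x [|y ys] stk] [[[] z]|] //= _;
  rewrite /used2 /= -?cats1 ?count_cat /= ?count_cat /= ?count_cat /=; lia.
Qed.

Lemma perm_log1 st t : valid st t ->
  perm_eq (log (@used1 T) st t ++ log (@skip1 T) st t ++ pend1 (run st t))
          (pend1 st ++ new_cells t).
Proof.
elim: t st => [|c t IHt] st /=; first by rewrite cats0.
case/andP=> /perm_step1 /seq.permP E1 /IHt /seq.permP E2; apply/seq.permP => p.
move: (E1 p) (E2 p); rewrite !count_cat -/(run _ _) /=.
by case: c {E1 E2} => [[b z]|] /=; lia.
Qed.

Lemma perm_log2 st t : valid st t ->
  perm_eq (log (@used2 T) st t ++ log (@skip2 T) st t ++ pend2 (run st t))
          (pend2 st ++ new_cells t).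
Proof.
elim: t st => [|c t IHt] st /=; first by rewrite cats0.
case/andP=> /perm_step2 /seq.permP E1 /IHt /seq.permP E2; apply/seq.permP => p.
move: (E1 p) (E2 p); rewrite !count_cat -/(run _ _) /=.
by case: c {E1 E2} => [[b z]|] /=; lia.
Qed.

End Accounting.

(** * Traces compatible with given gluings *)

Section Exploration.
Variables (T : eqType) (f1 f2 : T -> option T).
Implicit Types (c : move T) (st : state T) (t : seq (move T)).

Definition explore_move st : move T :=
  match st with
  | Busy out x xs stk =>
      if f2 x is Some z then
        Some (~~ (if xs is y :: _ then f1 y == Some z else false), z)
      else None
  | Idle ((x :: _) :: _) => omap (pair true) (f1 x)
  | Idle _ => None
  end.

Fixpoint explore fuel st : seq (move T) :=
  if fuel is fuel'.+1 then
    if final st then [::]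
    else explore_move st :: explore fuel' (upd (explore_move st) st)
  else [::].

Definition glued_as e := forall x,
  (f1 x == Some e.1) = (e.2.1 == Some x) /\ (f2 x == Some e.1) = (e.2.2 == Some x).

Definition realizes (E : seq (T * (option T * option T))) (s1 s2 : seq T) :=
  [/\ forall e, e \in E -> glued_as e, forall x, x \in s1 -> f1 x = None
    & forall x, x \in s2 -> f2 x = None].

Lemma realizes_cat E1 E2 s1 s1' s2 s2' :
  realizes (E1 ++ E2) (s1 ++ s1') (s2 ++ s2') <->
  realizes E1 s1 s2 /\ realizes E2 s1' s2'.
Proof.
split=> [[H1 H2 H3]|[[H1 H2 H3] [H1' H2' H3']]].
  by split; split=> ? h; do ?[apply: H1|apply: H2|apply: H3];
    rewrite mem_cat h ?orbT.
by split=> ?; rewrite mem_cat; case/orP=> h;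
  [apply: H1 | apply: H1' | apply: H2 | apply: H2' | apply: H3 | apply: H3'].
Qed.

Definition realizes_log st t :=
  realizes (log (@emit T) st t) (log (@skip1 T) st t) (log (@skip2 T) st t).

(** In each state the gluings force the letter, so a structure has at most one compatible complete
    trace. *)
Lemma explore_trace fuel st t : complete st t -> realizes_log st t ->
  size t <= fuel -> explore fuel st = t.
Proof.
elim: fuel st t => [|fuel IHf] st [|c t] //.
  by case/andP=> _ fin _ _ /=; rewrite ifT.
rewrite /complete /= -andbA => /and3P[en va fin] /realizes_cat[[Ec s1 s2] Et] ltf.
have -> : final st = false by case: st en {va fin Ec s1 s2 Et} => [[]|].
have -> : explore_move st = c; last by rewrite (IHf _ t) // /complete va fin.
case: st c en Ec s1 s2 {va fin Et}
  => [[|[|x xs] stk]|out x [|y ys] stk] [[[] z]|] //= _ Ec s1 s2.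
- have [/eqP] := Ec _ (mem_head _ _) x.
  by rewrite /= eqxx => ->.
- by rewrite s1 ?mem_head.
- have [_ /eqP] := Ec _ (mem_head _ _) x.
  by rewrite /= eqxx => ->.
- by rewrite s2 ?mem_head.
- have [_ /eqP] := Ec _ (mem_head _ _) x.
  by rewrite /= eqxx => ->; have [-> _] := Ec _ (mem_head _ _) y.
- have [_ /eqP] := Ec _ (mem_head _ _) x.
  rewrite /= eqxx => ->; have [-> _] := Ec _ (mem_head _ _) y.
  by rewrite eqxx.
- by rewrite s2 ?mem_head.
Qed.

Definition above x y := exists2 a, f1 a = Some x & f2 a = Some y.

Fixpoint column (s : seq T) : Prop :=
  if s is x :: s' then (if s' is y :: _ then above x y else True) /\ column s'
  else True.

Lemma column_rcons s z :
  column (rcons s z) <->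
  column s /\ (if s is x :: s' then above (last x s') z else True).
Proof.
elim: s => [|x [|y s] IHs] /=; first by split.
  by split=> [[]|[]].
by move: IHs => /= IHs; rewrite IHs; split=> [[? [[]]]|[[? []]]].
Qed.

(** The last clause says that the bottom cell of [out] is glued to the right upper edge of x; a cell
    glued to the right lower edge of x then extends the column [out], with x as common left
    neighbour. *)
Definition columns st : Prop :=
  match st with
  | Idle stk => forall s, s \in stk -> column s
  | Busy out x xs stk =>
      [/\ forall s, s \in stk -> column s, column (x :: xs), column out
        & if out is o :: os then f1 x = Some (last o os) else True]
  end.

Lemma columns_upd c st : enabled c st -> columns st ->
  (forall e, e \in emit c st -> glued_as e) -> columns (upd c st).
Proof.
case: st c => [[|[|x xs] stk]|out x [|y ys] stk] [[[] z]|] //= _.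
- by move=> H _ s sS; apply: H; rewrite in_cons sS orbT.
- move=> H Ec; split=> //; last first.
  + by have [/eqP] := Ec _ (mem_head _ _) x; rewrite /= eqxx => ->.
  + exact: (H (x :: xs) (mem_head _ _)).
  by move=> s sS; apply: H; rewrite in_cons sS orbT.
- move=> H _; split=> //; last exact: (H (x :: xs) (mem_head _ _)).
  by move=> s sS; apply: H; rewrite in_cons sS orbT.
- move=> [H _ Ho Hx] Ec s; rewrite !in_cons => /or3P[/eqP->|/eqP->|/H] //.
  apply/column_rcons; split=> //; case: out Ho Hx Ec => // o os _ f1x Ec.
  exists x => //.
  by have [_ /eqP] := Ec _ (mem_head _ _) x; rewrite /= eqxx => ->.
- by move=> [H _ Ho Hx] _ s; rewrite !in_cons => /or3P[/eqP->|/eqP->|/H].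
- move=> [H [_ Hy] Ho Hx] Ec s; rewrite !in_cons => /or3P[/eqP->|/eqP->|/H] //.
  apply/column_rcons; split=> //; case: out Ho Hx Ec => // o os _ f1x Ec.
  exists x => //.
  by have [_ /eqP] := Ec _ (mem_head _ _) x; rewrite /= eqxx => ->.
- move=> [H [_ Hy] Ho Hx] Ec; split=> //.
    apply/column_rcons; split=> //; case: out Ho Hx Ec => // o os _ f1x Ec.
    exists x => //.
    by have [_ /eqP] := Ec _ (mem_head _ _) x; rewrite /= eqxx => ->.
  have [/eqP] := Ec _ (mem_head _ _) y; rewrite /= eqxx => ->.
  by case: out {Ho Hx Ec} => //= o os; rewrite last_rcons.
- by move=> [H [_ Hy] Ho Hx] _ s; rewrite !in_cons => /or3P[/eqP->|/eqP->|/H].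
Qed.

(** This is the side condition of operation (iii): the two cells closed by the new one are
    consecutive in a column, hence have a common left neighbour. *)
Lemma emit_above st t : valid st t -> columns st -> realizes_log st t ->
  forall z x y, (z, (Some y, Some x)) \in log (@emit T) st t -> above x y.
Proof.
elim: t st => //= c t IHt st /andP[en va] Cst /realizes_cat[[Ec _ _] Et] z x y.
rewrite mem_cat => /orP[Hz|]; last by apply: IHt => //; apply: columns_upd.
case: st c en Cst Hz {va Ec Et} => [[|[|x' xs] stk]|out x' [|y' ys] stk] [[[] z']|]
  //= _ Cst; rewrite mem_seq1 => /eqP[] // _ -> ->.
by case: Cst => _ [].
Qed.

Lemma emit_shape st t : valid st t ->
  forall e, e \in log (@emit T) st t -> e.2 != (None, None).
Proof.
elim: t st => //= c t IHt st /andP[en va] e.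
rewrite mem_cat => /orP[He|]; last exact: IHt.
by case: st c en He {va} => [[|[|x' xs] stk]|out x' [|y' ys] stk] [[[] z']|]
  //= _; rewrite inE => /eqP->.
Qed.

(** A left neighbour is pending when a cell is glued to it, so it was created earlier. Hence the
    order of exploration is also an order of construction. *)
Lemma emit_order (lt : rel T) st t :
    valid st t -> allrel lt (pend2 st) (new_cells t) ->
    pairwise lt (new_cells t) ->
  forall e x, e \in log (@emit T) st t -> e.2.1 = Some x \/ e.2.2 = Some x ->
    lt x e.1.
Proof.
elim: t st => //= c t IHt st /andP[en va] Rst Pt e x.
have Rc : allrel lt (pend2 st) (new_cells t) && pairwise lt (new_cells t).
  case: c Rst Pt {en va} => [[b z]|] /= Rst Pt; last by rewrite Rst.
  case/andP: Pt => _ ->; rewrite andbT; apply/allrelP => u v u_ v_.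
  by apply: (allrelP Rst); rewrite // in_cons v_ orbT.
rewrite mem_cat => /orP[He|]; last first.
  case/andP: Rc => Rc Pt'.
  apply: IHt => //; apply/allrelP => u v u_ v_.
  have : u \in pend2 st ++ new_cells [:: c].
    by rewrite -(perm_mem (perm_step2 en)) !mem_cat u_ !orbT.
  rewrite mem_cat => /orP[u_st|]; first exact: (allrelP Rc).
  case: c Pt {en va Rst u_} => [[b z]|] //= /andP[/allP H _].
  by rewrite inE => /eqP->; apply: H.
have {He} [ze px] : e.1 \in new_cells (c :: t) /\
    (e.2.1 = Some x \/ e.2.2 = Some x -> x \in pend2 st).
  case: st c en He {va Rst Pt Rc} => [[|[|x' xs] stk]|out x' [|y' ys] stk]
    [[[] z']|] //= _; rewrite mem_seq1 => /eqP-> /=;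
  by split; rewrite ?mem_head // => -[] // [<-];
    rewrite ?mem_head // ?mem_cat ?in_cons ?eqxx ?orbT //.
by move=> /px x_st; apply: (allrelP Rst).
Qed.

(** The condition on busy states persists: a segment starts with [out] empty exactly if the right
    upper edge of its first cell is free, and each later cell of the segment has that edge glued
    while [out] is nonempty. *)
Lemma tail_log st t : valid st t -> realizes_log st t ->
    (if st is Busy out x _ _ then nilp out = ~~ f1 x else True) ->
  log (@tail_cell T) st t = [seq x <- log (@skip2 T) st t | ~~ f1 x].
Proof.
elim: t st => //= c t IHt st /andP[en va] /realizes_cat[[Ec s1 _] Et] busy.
rewrite filter_cat -IHt //.
  congr (_ ++ _).
  by case: st c en busy {va Ec s1 Et} => [[|[|x xs] stk]|[|o os] x xs stk]
    [[[] z]|] //= _ <-.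
case: st c en busy Ec s1 {va Et} => [[|[|x xs] stk]|out x [|y ys] stk]
  [[[] z]|] //= _ _ Ec s1.
- by have [/eqP] := Ec _ (mem_head _ _) x; rewrite /= eqxx => ->.
- by rewrite s1 ?mem_head.
- have [/eqP] := Ec _ (mem_head _ _) y; rewrite /= eqxx => -> _.
  by case: (out).
Qed.

End Exploration.

(** * Exploration reads every gluing correctly *)

Section ExplorationIsFaithful.
Variables (T : eqType) (f1 f2 : T -> option T).
Implicit Types (c : move T) (st : state T) (t : seq (move T)) (V : seq T).
Local Notation above := (above f1 f2).
Local Notation explore_move := (explore_move f1 f2).
Local Notation explore := (explore f1 f2).

Hypothesis f1_inj : forall x y z, f1 x = Some z -> f1 y = Some z -> x = y.
Hypothesis f2_inj : forall x y z, f2 x = Some z -> f2 y = Some z -> x = y.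
Hypothesis f_square : forall x y z, f2 x = Some z -> f1 y = Some z -> above x y.

(* Maximality of the column [s]: no right lower edge is glued to the cell on the
   right upper edge of its first cell, and no cell lies just below its last cell.
   Hence two cells completed by operation (iii) are consecutive in a column. *)
Definition top_open s :=
  if s is x :: _ then forall b z, f2 b = Some z -> f1 x <> Some z else True.

Definition bottom_open s :=
  if s is x :: s' then forall a, f1 a = Some (last x s') -> f2 a = None else True.

(** In a busy state the top of the current column has been passed and the bottom of [out] is not yet
    decided, so only the two other margins are kept. *)
Definition margins st : Prop :=
  match st with
  | Idle stk => forall s, s \in stk -> top_open s /\ bottom_open s
  | Busy out x xs stk =>
      [/\ forall s, s \in stk -> top_open s /\ bottom_open s,
          bottom_open (x :: xs), top_open out & nilp out -> f1 x = None]
  end.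

(** [V] lists the cells discovered so far. By the fourth clause, an edge still to be settled never
    leads to a cell of [V]. *)
Definition invariant V st : Prop :=
  [/\ uniq V, uniq (pend2 st), {subset pend2 st <= V},
      (forall x z, z \in V -> f1 x = Some z -> x \in V /\ x \notin pend1 st)
      /\ (forall x z, z \in V -> f2 x = Some z -> x \in V /\ x \notin pend2 st)
    & columns f1 f2 st /\ margins st].

(** Testing the next cell of the column suffices: if z is glued to the right lower edge of x and the
    right upper edge of y, then x and y have a common left neighbour by [f_square], so y follows x
    in the column, unless x is its last cell, which [bottom_open] excludes. *)
Lemma explore_move_realizes st : ~~ final st -> columns f1 f2 st -> margins st ->
  [/\ enabled (explore_move st) st,
      realizes f1 f2 (emit (explore_move st) st) (skip1 (explore_move st) st)
        (skip2 (explore_move st) st)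
    & margins (upd (explore_move st) st)].
Proof.
case: st => [[|[|x xs] stk]|out x xs stk] //= _.
- move=> _ H; split=> // s sS; apply: H; by rewrite in_cons sS orbT.
- move=> Hc H; have Hstk s : s \in stk -> top_open s /\ bottom_open s.
    by move=> sS; apply: H; rewrite in_cons sS orbT.
  have [top_x bot_x] := H (x :: xs) (mem_head _ _).
  case f1x: (f1 x) => [z|] /=; last first.
    by split=> //; split=> // y; rewrite inE => /eqP->.
  have z_top b : f2 b <> Some z by move=> /top_x; rewrite f1x.
  have Gz : glued_as f1 f2 (z, (Some x, None)).
    move=> y /=; split; last by apply/eqP/z_top.
    by apply/eqP/eqP=> [/f1_inj/(_ f1x)->|[<-]].
  split=> //; first by split=> // e; rewrite inE => /eqP->.
  split=> // b w f2b f1z; have [a _ /z_top] := f_square f2b f1z; exact.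
move=> [_ Hx _ Hout] [Hstk bot_x top_out nil_out].
have R a y : f1 a = Some x -> f2 a = Some y -> ohead xs = Some y.
  move=> f1a f2a; case: xs Hx bot_x => [|y' ys] /= [].
    by move=> _ _ /(_ _ f1a); rewrite f2a.
  by move=> [a' /f1_inj/(_ f1a)-> ] + _ _; rewrite f2a.
have bot_xs : bottom_open xs by case: xs Hx bot_x {R} => //= y ys _.
(* The first cell y of [xs] shares a left neighbour with x, so a violation of [top_open] would be a
   cell glued to both x and y, and the segment would not end at x. *)
have top_xs z : (forall y ys, xs = y :: ys -> f2 x = Some z -> f1 y <> Some z) ->
    (f2 x = None \/ f2 x = Some z) -> top_open xs.
  case: xs Hx {bot_x R bot_xs} => //= y ys [[a f1a f2a] _] /(_ _ _ erefl) N f2x.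
  move=> b w f2b f1y; have [a' f1a' f2a'] := f_square f2b f1y.
  have ea := f2_inj f2a' f2a; rewrite ea f1a in f1a'.
  case: f1a' => eb; case: f2x; rewrite eb f2b // => -[ewz].
  by apply: N; rewrite ?eb -?ewz.
have top_z z : f2 x = Some z -> top_open (rcons out z).
  move=> f2x; case: out top_out nil_out {Hout} => // _ /(_ isT) f1x b w f2b f1z.
  have [a f1a f2a] := f_square f2b f1z.
  by rewrite (f2_inj f2a f2x) f1x in f1a.
case f2x: (f2 x) => [z|] /=; last first.
  split; [by case: (xs) | by split=> // y; rewrite inE => /eqP-> |].
  move=> s; rewrite !in_cons => /or3P[/eqP->|/eqP->|/Hstk //]; split=> //.
    case: out Hout {top_z top_out nil_out} => //= o os f1x a.
    by move=> /f1_inj/(_ f1x)->.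
  by apply: (top_xs x); [rewrite f2x | left].
case Jx: (if xs is y :: _ then f1 y == Some z else false) => /=.
  case: xs Jx Hx bot_x R bot_xs top_xs => //= y ys /eqP f1y _ _ _ bot_xs _.
  split=> //; last by split=> //; [apply: top_z | case: (out)].
  split=> // e; rewrite inE => /eqP-> u /=.
  split; apply/eqP/eqP=> [|[<-] //]; first by move=> /f1_inj/(_ f1y)->.
  by move=> /f2_inj/(_ f2x)->.
have z_left y : f1 y <> Some z.
  move=> f1y; have [a f1a f2a] := f_square f2x f1y.
  by have := R _ _ f1a f2a; case: xs Jx {Hx bot_x R bot_xs top_xs} => //= y' ys
    /eqP Jx [ey]; rewrite ey in Jx.
split=> //; first by case: (xs).
  split=> // e.
  rewrite inE => /eqP-> u /=; split; first by apply/eqP/z_left.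
  by apply/eqP/eqP=> [/f2_inj/(_ f2x)->|[<-]].
suff: margins (Idle (rcons out z :: xs :: stk)) by case: (xs).
move=> s; rewrite !in_cons => /or3P[/eqP->|/eqP->|/Hstk //]; split=> //.
- exact: top_z.
- case: (out) => /= [|o os] a; last by rewrite last_rcons => /z_left.
  by move=> /z_left.
- by apply: (top_xs z); [move=> y ys _ _; apply: z_left | right].
Qed.

Lemma invariant_upd V st (c := explore_move st) : ~~ final st -> invariant V st ->
  [/\ enabled c st, realizes f1 f2 (emit c st) (skip1 c st) (skip2 c st)
    & invariant (V ++ new_cells [:: c]) (upd c st)].
Proof.
move=> nfin [uV uP sP [V1 V2] [Cst Mst]].
have [en Rc Mst'] := explore_move_realizes nfin Cst Mst.
have [Ec _ _] := Rc.
have sub12 : subseq (pend1 st) (pend2 st).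
  by case: (st) => //= out x xs stk; rewrite cat_subseq // -cat1s suffix_subseq.
have sP1 : {subset pend1 st <= pend2 st} := mem_subseq sub12.
(* The left neighbours of a discovered cell have settled edges, while the edge followed here is
   pending. *)
have newE z : z \in new_cells [:: c] -> z \notin V.
  rewrite /c; case: (st) V1 V2 {uP sP sub12 sP1 nfin Cst Mst en Rc Mst' Ec c}
    => [[|[|x xs] stk]|out x xs stk] //= V1 V2.
    case f1x: (f1 x) => [z'|] //=; rewrite mem_seq1 => /eqP->.
    by apply/negP => /V1/(_ f1x)[_]; rewrite mem_head.
  case f2x: (f2 x) => [z'|] //=; rewrite mem_seq1 => /eqP->.
  by apply/negP => /V2/(_ f2x)[_]; rewrite mem_cat mem_head orbT.
have uN : uniq (new_cells [:: c]) by case: (c) => [[]|].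
have uPN (P : seq T) : uniq P -> {subset P <= V} -> uniq (P ++ new_cells [:: c]).
  move=> uPs sPs; rewrite cat_uniq uPs uN andbT; apply/hasPn => z /newE.
  by apply: contra => /sPs.
have emitE z : z \in new_cells [:: c] -> exists2 e, e \in emit c st & e.1 = z.
  rewrite -(@emit_new _ st) /= ?en // cats0 => /mapP[e e_c ->]; by exists e.
have p1 := perm_step1 en; have p2 := perm_step2 en.
have sV1 : {subset pend1 st <= V} by move=> x /sP1/sP.
have u1 := uPN _ (subseq_uniq sub12 uP) sV1; have u2 := uPN _ uP sP.
have keep (P P' : seq T) x : {subset P' <= P ++ new_cells [:: c]} ->
    x \in V -> x \notin P -> x \notin P'.
  move=> sPP xV xP; apply/negP => /sPP; rewrite mem_cat (negPf xP) /= => /newE.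
  by rewrite xV.
have s1 : {subset pend1 (upd c st) <= pend1 st ++ new_cells [:: c]}.
  by move=> x x1; rewrite -(perm_mem p1) !mem_cat x1 !orbT.
have s2 : {subset pend2 (upd c st) <= pend2 st ++ new_cells [:: c]}.
  by move=> x x2; rewrite -(perm_mem p2) !mem_cat x2 !orbT.
split=> //; split; first exact: uPN.
- by move: u2; rewrite -(perm_uniq p2) !cat_uniq => /and5P[].
- by move=> x /s2; rewrite !mem_cat => /orP[/sP->|->]; rewrite ?orbT.
- split=> x z; rewrite !mem_cat => /orP[zV|/emitE[e e_c <-]] fx.
  + by have [xV x1] := V1 _ _ zV fx; split; [rewrite xV | apply: keep s1 xV x1].
  + have x_used : x \in used1 c st.
      have [/esym] := Ec _ e_c x; rewrite fx eqxx => /eqP ex _.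
      by rewrite mem_pmap; apply/mapP; exists e.
    have := u1; rewrite -(perm_uniq p1) cat_uniq => /and3P[_ /hasPn H _].
    split; last by apply/negP => x1; have := H x; rewrite mem_cat x1 orbT x_used => /(_ isT).
    have : x \in pend1 st ++ new_cells [:: c] by rewrite -(perm_mem p1) mem_cat x_used.
    by rewrite mem_cat => /orP[/sV1->|->]; rewrite ?orbT.
  + by have [xV x2] := V2 _ _ zV fx; split; [rewrite xV | apply: keep s2 xV x2].
  + have x_used : x \in used2 c st.
      have [_ /esym] := Ec _ e_c x; rewrite fx eqxx => /eqP ex.
      by rewrite mem_pmap; apply/mapP; exists e.
    have := u2; rewrite -(perm_uniq p2) cat_uniq => /and3P[_ /hasPn H _].
    split; last by apply/negP => x2; have := H x; rewrite mem_cat x2 orbT x_used => /(_ isT).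
    have : x \in pend2 st ++ new_cells [:: c] by rewrite -(perm_mem p2) mem_cat x_used.
    by rewrite mem_cat => /orP[/sP->|->]; rewrite ?orbT.
by split=> //; apply: columns_upd.
Qed.

Lemma explore_faithful fuel V st (t := explore fuel st) : invariant V st ->
  [/\ valid st t, realizes_log f1 f2 st t, uniq (V ++ new_cells t)
    & final (run st t) \/ size t = fuel].
Proof.
rewrite {}/t; elim: fuel V st => [|fuel IHf] V st inv /=.
  by split=> //; [case: inv => ?; rewrite cats0 | right].
case: ifPn => [fin|nfin] /=.
  by split=> //; [case: inv => ?; rewrite cats0 | left].
have [en Rc inv'] := invariant_upd nfin inv.
have [va Rt ut sz] := IHf _ _ inv'; rewrite en va; split=> //.
- exact/realizes_cat.
- by move: ut; rewrite -catA; case: (explore_move st) => [[]|].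
- by case: sz => [|->]; [left | right].
Qed.

End ExplorationIsFaithful.

(** * Structures and words *)

Section Presentation.
Variable n : nat.
Implicit Types (S : fstruct n.+1) (t : seq (move 'I_n.+1)) (s : {perm 'I_n.+1}).

Definition head_state : state 'I_n.+1 := Idle [:: [:: ord0]].

(** Each of [S] and [t] determines the other, and the trace reaches every cell, starting from the
    head [ord0]. *)
Definition presents S t : Prop :=
  [/\ complete head_state t, realizes_log S.1 S.2 head_state t
    & perm_eq (ord0 :: new_cells t) (enum 'I_n.+1)].

Definition glue_log t := log (@emit _) head_state t.
Definition skip1_log t := log (@skip1 _) head_state t.
Definition skip2_log t := log (@skip2 _) head_state t.

Lemma complete_perm1 t : complete head_state t ->
  perm_eq (log (@used1 _) head_state t ++ skip1_log t)
          (ord0 :: new_cells t).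
Proof.
case/andP=> va fin; have := perm_log1 va.
by case: (run _ _) fin => [[]|] // _; rewrite /= cats0.
Qed.

Lemma complete_perm2 t : complete head_state t ->
  perm_eq (log (@used2 _) head_state t ++ skip2_log t)
          (ord0 :: new_cells t).
Proof.
case/andP=> va fin; have := perm_log2 va.
by case: (run _ _) fin => [[]|] // _; rewrite /= cats0.
Qed.

Lemma mem_used1 t x : x \in log (@used1 _) head_state t ->
  exists2 e, e \in glue_log t & e.2.1 = Some x.
Proof.
have -> : log (@used1 _) head_state t = pmap (fun e => e.2.1) (glue_log t).
  by rewrite pmap_log.
by rewrite mem_pmap => /mapP[e e_t ex]; exists e.
Qed.

Lemma mem_used2 t x : x \in log (@used2 _) head_state t ->
  exists2 e, e \in glue_log t & e.2.2 = Some x.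
Proof.
have -> : log (@used2 _) head_state t = pmap (fun e => e.2.2) (glue_log t).
  by rewrite pmap_log.
by rewrite mem_pmap => /mapP[e e_t ex]; exists e.
Qed.

Lemma glue_new t : complete head_state t -> map fst (glue_log t) = new_cells t.
Proof. by case/andP=> va _; apply: emit_new. Qed.

Lemma presents_glue1 S t x z : presents S t ->
  S.1 x = Some z <-> exists2 e, e \in glue_log t & e.1 = z /\ e.2.1 = Some x.
Proof.
case=> co [Et s1 _] pt; split=> [Sx|[e e_t [<- ex]]]; last first.
  by have [/eqP] := Et _ e_t x; rewrite ex eqxx => /eqP/eqP.
have: x \in log (@used1 _) head_state t ++ skip1_log t.
  by rewrite (perm_mem (complete_perm1 co)) (perm_mem pt) mem_enum.
rewrite mem_cat => /orP[|/s1]; last by rewrite Sx.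
case/mem_used1=> e e_t ex; exists e => //; split=> //.
by have [/eqP] := Et _ e_t x; rewrite ex eqxx Sx => /eqP/eqP[].
Qed.

Lemma presents_glue2 S t x z : presents S t ->
  S.2 x = Some z <-> exists2 e, e \in glue_log t & e.1 = z /\ e.2.2 = Some x.
Proof.
case=> co [Et _ s2] pt; split=> [Sx|[e e_t [<- ex]]]; last first.
  by have [_ /eqP] := Et _ e_t x; rewrite ex eqxx => /eqP/eqP.
have: x \in log (@used2 _) head_state t ++ skip2_log t.
  by rewrite (perm_mem (complete_perm2 co)) (perm_mem pt) mem_enum.
rewrite mem_cat => /orP[|/s2]; last by rewrite Sx.
case/mem_used2=> e e_t ex; exists e => //; split=> //.
by have [_ /eqP] := Et _ e_t x; rewrite ex eqxx Sx => /eqP/eqP[].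
Qed.

Lemma presents_uniq S t : presents S t -> uniq (ord0 :: new_cells t).
Proof. by case=> _ _ /perm_uniq ->; apply: enum_uniq. Qed.

Lemma presents_new S t z : presents S t -> (z \in new_cells t) = (z != ord0).
Proof.
move=> pS; have [_ _ /perm_mem/(_ z)] := pS.
have := presents_uniq pS; rewrite mem_enum in_cons /= => /andP[].
by case: eqP => //= ->; case: (ord0 \in _).
Qed.

Lemma presents_functional S S' t : presents S t -> presents S' t -> S = S'.
Proof.
move=> pS pS'; case: S pS => S1 S2 pS; case: S' pS' => S1' S2' pS'.
congr pair; apply/ffunP => x.
- have E z : (S1 x = Some z) <-> (S1' x = Some z).
    exact: (iff_trans (presents_glue1 x z pS) (iff_sym (presents_glue1 x z pS'))).
  case S1x: (S1 x) => [z|]; first by have /E -> := S1x.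
  by case S1x': (S1' x) => [z|] //; have /E := S1x'; rewrite S1x.
- have E z : (S2 x = Some z) <-> (S2' x = Some z).
    exact: (iff_trans (presents_glue2 x z pS) (iff_sym (presents_glue2 x z pS'))).
  case S2x: (S2 x) => [z|]; first by have /E -> := S2x.
  by case S2x': (S2' x) => [z|] //; have /E := S2x'; rewrite S2x.
Qed.

Lemma presents_explore S t fuel : presents S t -> size t <= fuel ->
  explore S.1 S.2 fuel head_state = t.
Proof. by case=> co re _; apply: explore_trace. Qed.

Lemma relabelE s S x : ((relabel s S).1 (s x) = omap s (S.1 x)) *
  ((relabel s S).2 (s x) = omap s (S.2 x)).
Proof. by rewrite /relabel /= !ffunE permK. Qed.

Lemma presents_relabel s S t : s ord0 = ord0 -> presents S t ->
  presents (relabel s S) (map (map_move s) t).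
Proof.
move=> s0 [co [Et s1 s2] pt].
have hs : head_state = map_state s head_state by rewrite /= s0.
split; first by rewrite hs map_complete.
  rewrite /realizes_log hs (map_log_natural (map_emit _)).
  rewrite (map_log_natural (map_skip1 _)) (map_log_natural (map_skip2 _)).
  split=> _ /mapP[e e_t ->].
  - move=> y; rewrite -[y](permKV s); move: (_ y) => x {y}.
    have [E1 E2] := Et e e_t x; rewrite !relabelE /=.
    have omapE (u v : option 'I_n.+1) : (omap s u == omap s v) = (u == v).
      by apply: inj_eq => -[x'|] [y'|] //= [/perm_inj->].
    by rewrite -[Some (s e.1)]/(omap s (Some e.1)) -[Some (s x)]/(omap s (Some x))
      !omapE.
  - by rewrite relabelE s1.
  - by rewrite relabelE s2.
rewrite map_new_cells -s0 -map_cons; apply: uniq_perm.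
- by rewrite (map_inj_uniq perm_inj) (perm_uniq pt) enum_uniq.
- exact: enum_uniq.
move=> y; rewrite -[y](permKV s) (mem_map perm_inj) (perm_mem pt) !mem_enum.
by [].
Qed.

Definition canonical_cells : seq 'I_n.+1 := behead (enum 'I_n.+1).

Lemma enum_canonical : enum 'I_n.+1 = ord0 :: canonical_cells.
Proof. by rewrite /canonical_cells enum_ordSl. Qed.

Lemma size_canonical : size canonical_cells = n.
Proof. by rewrite size_behead size_enum_ord. Qed.

(** Numbering the cells in order of creation leaves no information in the trace besides its word. *)
Lemma presents_canonical S t : presents S t ->
  exists2 s : {perm 'I_n.+1}, s ord0 = ord0 &
    presents (relabel s S) (label (word t) canonical_cells).
Proof.
move=> pS; have uV := presents_uniq pS; have [_ _ pt] := pS.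
pose V := ord0 :: new_cells t.
have V_all x : x \in V by rewrite (perm_mem pt) mem_enum.
have szV : size V = n.+1 by rewrite (perm_size pt) size_enum_ord.
pose sf x : 'I_n.+1 := inord (index x V).
have sfE x : sf x = index x V :> nat by apply/inordK; have := V_all x; rewrite -index_mem szV.
have sf_inj : injective sf.
  by move=> x y /(congr1 val) /=; rewrite !sfE => /index_inj ->.
have sV : map (perm sf_inj) V = enum 'I_n.+1.
  apply: (inj_map val_inj); rewrite val_enum_ord -map_comp.
  apply: (@eq_from_nth _ 0); rewrite size_map szV ?size_iota // => i lti.
  rewrite (nth_map ord0) ?szV // nth_iota // add0n /= permE sfE index_uniq //.
  by rewrite szV.
have [s0 sN] : perm sf_inj ord0 = ord0 /\
    map (perm sf_inj) (new_cells t) = canonical_cells.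
  by move: sV; rewrite enum_canonical => -[].
exists (perm sf_inj) => //; rewrite -sN -map_label.
by rewrite label_word; apply: presents_relabel.
Qed.

Lemma presents_tails S t : presents S t ->
  log (@tail_cell _) head_state t = [seq x <- skip2_log t | ~~ S.1 x].
Proof. by case=> /andP[va _] re _; rewrite (tail_log va re). Qed.

Lemma presents_skip2 S t x : presents S t -> (x \in skip2_log t) = (S.2 x == None).
Proof.
move=> pS; have [co [_ _ s2] pt] := pS; apply/idP/eqP => [/s2 //|Sx].
have: x \in log (@used2 _) head_state t ++ skip2_log t.
  by rewrite (perm_mem (complete_perm2 co)) (perm_mem pt) mem_enum.
rewrite mem_cat => /orP[/mem_used2[e e_t ex]|//].
have : S.2 x = Some e.1 by apply/(presents_glue2 _ _ pS); exists e.
by rewrite Sx.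
Qed.

Lemma skip2_uniq S t : presents S t -> uniq (skip2_log t).
Proof.
move=> pS; have [co _ _] := pS.
by have := presents_uniq pS; rewrite -(perm_uniq (complete_perm2 co)) cat_uniq => /and3P[].
Qed.

Lemma presents_final S t x : presents S t ->
  (x \in log (@tail_cell _) head_state t) = final_cell S x.
Proof.
move=> pS; rewrite (presents_tails pS) mem_filter (presents_skip2 _ pS).
by rewrite /final_cell; case: (S.1 x).
Qed.

Lemma tails_uniq S t : presents S t -> uniq (log (@tail_cell _) head_state t).
Proof.
by move=> pS; rewrite (presents_tails pS) filter_uniq ?(skip2_uniq pS).
Qed.

Lemma presents_free_rl S t : presents S t -> n_free_rl S = size (skip2_log t).
Proof.
move=> pS; rewrite /n_free_rl -(card_uniqP (skip2_uniq pS)).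
by apply: eq_card => x; rewrite inE (presents_skip2 _ pS).
Qed.

(** The successor accounts for the head, whose left lower edge is free but which is never
    emitted. *)
Lemma presents_free_ll S t : presents S t ->
  n_free_ll S = (size (log (@open_left _) head_state t)).+1.
Proof.
move=> pS; have [co _ _] := pS; have := presents_uniq pS.
rewrite -(glue_new co) => /= /andP[n0 uE].
rewrite /n_free_ll -filter_log -/(glue_log t).
set E := filter _ _; rewrite -(size_map fst) -/(size (ord0 :: map fst E)).
have uL : uniq (ord0 :: map fst E).
  rewrite /= (subseq_uniq (map_subseq _ (filter_subseq _ _)) uE) andbT.
  by apply: contra n0; apply/mem_subseq/map_subseq/filter_subseq.
rewrite -(card_uniqP uL); apply: eq_card => z; rewrite inE in_cons.
have [_ [Et _ _] _] := pS.
apply/idP/idP => [/existsPn free|/predU1P[->|/mapP[e]]].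
- case: eqP => //= /eqP z0; have : z \in map fst (glue_log t).
    by rewrite glue_new // (presents_new _ pS).
  case/mapP=> e e_t ze; rewrite ze; apply: map_f; rewrite mem_filter e_t andbT.
  case e1: e.2.1 => [x|] //; have /negP[] := free x; apply/eqP.
  by apply/(presents_glue1 _ _ pS); exists e.
- apply/existsPn => x; apply/eqP => /(presents_glue1 _ _ pS)[e e_t [e0 _]].
  by case/negP: n0; rewrite -e0 map_f.
rewrite mem_filter => /andP[e1 e_t ->]; apply/existsPn => x.
by have [-> _] := Et _ e_t x; case: e.2.1 e1.
Qed.

(** * From constructible structures to traces *)

Section OrderedConstructible.
Variable S : fstruct n.+1.
Hypothesis OC : ordered_constructible S.

Lemma oc_inj1 x y z : S.1 x = Some z -> S.1 y = Some z -> x = y.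
Proof.
case/and4P: OC => _ /forallP/(_ x)/forallP/(_ y)/forallP/(_ z)/implyP H _ _ Sx Sy.
by apply/eqP/H; rewrite Sx Sy eqxx.
Qed.

Lemma oc_inj2 x y z : S.2 x = Some z -> S.2 y = Some z -> x = y.
Proof.
case/and4P: OC => _ _ /forallP/(_ x)/forallP/(_ y)/forallP/(_ z)/implyP H _ Sx Sy.
by apply/eqP/H; rewrite Sx Sy eqxx.
Qed.

Lemma oc_head x : S.1 x <> Some ord0 /\ S.2 x <> Some ord0.
Proof.
case/and4P: OC => _ _ _ /forallP/(_ ord0) /= /andP[/existsPn H1 /existsPn H2].
by split; apply/eqP; [apply: H1 | apply: H2].
Qed.

(** Only operation (iii) glues both left edges of a cell, and its cell a is the common left
    neighbour. *)
Lemma oc_square x y z : S.2 x = Some z -> S.1 y = Some z -> above S.1 S.2 x y.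
Proof.
move=> Sx Sy; have z0 : val z != 0.
  apply/eqP => z0; have [] := oc_head y; rewrite Sy; case; congr Some.
  exact: val_inj.
case/and4P: OC => _ _ _ /forallP/(_ z); rewrite (negPf z0).
have -> : ll_glued S z by apply/existsP; exists y; rewrite Sy.
have -> : lu_glued S z by apply/existsP; exists x; rewrite Sx.
rewrite !andbF /= => /existsP[a /existsP[b /existsP[c]]].
case/and5P=> _ _ _ /eqP Sa1 /and3P[/eqP Sa2 /eqP Sb /eqP Sc].
by exists a; rewrite ?(oc_inj2 Sx Sb) ?(oc_inj1 Sy Sc).
Qed.

Lemma oc_parent z : z != ord0 ->
  exists2 x : 'I_n.+1, x < z & S.1 x = Some z \/ S.2 x = Some z.
Proof.
move=> z0; case/and4P: OC => _ _ _ /forallP/(_ z).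
rewrite ifF; last by apply: contraNF z0 => /eqP z0; apply/eqP/val_inj.
case/or3P=> [/andP[/existsP[a /andP[lta /eqP Sa]] _]
            |/andP[/existsP[a /andP[lta /eqP Sa]] _]|].
- by exists a; [|left].
- by exists a; [|right].
case/existsP=> a /existsP[b /existsP[c /and5P[_ ltb _ _ /and3P[_ /eqP Sb _]]]].
by exists b; [|right].
Qed.

Lemma ordered_constructible_presented : exists t, presents S t.
Proof.
have inv : invariant S.1 S.2 [:: ord0] head_state.
  split=> //.
    by split=> x z; rewrite mem_seq1 => /eqP-> H; have [] := oc_head x.
  split=> [s|s]; rewrite mem_seq1 => /eqP->; first by split.
  split=> /= [b z|a] H; last by have [] := oc_head a.
  by move=> H1; have [a _ Sa] := oc_square H H1; have [_] := oc_head a.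
(* By [size_log_stack] a trace has at most 3 (2 (n + 1)) + 1 letters, one unit coming from the
   initial stack, so this fuel is never exhausted. *)
have := explore_faithful oc_inj1 oc_inj2 oc_square (6 * n.+1 + 2) inv.
move: (explore _ _ _ _) => t [va re ut sz]; exists t.
have szV : size (new_cells t) < n.+1.
  have := uniq_leq_size ut (s2 := enum 'I_n.+1).
  by rewrite size_enum_ord; apply=> x; rewrite mem_enum.
have co : complete head_state t.
  rewrite /complete va; case: sz => // szt; have := size_log_stack va.
  have le1 : size (log (@used1 'I_n.+1) head_state t)
      + size (log (@skip1 'I_n.+1) head_state t) <= n.+1.
    have := perm_size (perm_log1 va); rewrite !size_cat addnA => E.
    exact: leq_trans (leq_trans (leq_addr _ _) (eq_leq E)) szV.
  have le2 : size (log (@used2 'I_n.+1) head_state t)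
      + size (log (@skip2 'I_n.+1) head_state t) <= n.+1.
    have := perm_size (perm_log2 va); rewrite !size_cat addnA => E.
    exact: leq_trans (leq_trans (leq_addr _ _) (eq_leq E)) szV.
  by rewrite szt /=; lia.
split=> //; apply: uniq_perm; [exact: ut | exact: enum_uniq |].
(* Every cell is reached, by induction on its label: a cell other than the head is glued to one with
   a smaller label. *)
suff H k (z : 'I_n.+1) : z < k -> z \in ord0 :: new_cells t.
  by move=> z; rewrite mem_enum (H n.+1).
elim: k z => // k IHk z; rewrite ltnS => lezk.
have [->|z0] := eqVneq z ord0; first exact: mem_head.
have [x ltxz Sx] := oc_parent z0; have := IHk x (leq_trans ltxz lezk).
rewrite in_cons -(glue_new co) => Vx; rewrite in_cons (negPf z0) /=.
have [Et s1 s2] := re.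
case: Sx => Sx.
  have: x \in log (@used1 _) head_state t ++ skip1_log t.
    by rewrite (perm_mem (complete_perm1 co)) in_cons -(glue_new co).
  rewrite mem_cat => /orP[/mem_used1[e e_t ex]|/s1]; last by rewrite Sx.
  have [/eqP] := Et _ e_t x; rewrite ex eqxx Sx => /eqP/eqP[->] _.
  exact: map_f.
have: x \in log (@used2 _) head_state t ++ skip2_log t.
  by rewrite (perm_mem (complete_perm2 co)) in_cons -(glue_new co).
rewrite mem_cat => /orP[/mem_used2[e e_t ex]|/s2]; last by rewrite Sx.
have [_ /eqP] := Et _ e_t x; rewrite ex eqxx Sx => /eqP/eqP[->].
exact: map_f.
Qed.

End OrderedConstructible.

Lemma pmap_uniq_inj (A B : eqType) (g : A -> option B) (s : seq A) x e e' :
  uniq (pmap g s) -> e \in s -> e' \in s -> g e = Some x -> g e' = Some x -> e = e'.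
Proof.
elim: s => //= a s IHs; rewrite !in_cons => u.
have us : uniq (pmap g s) by move: u; case: (g a) => //= y /andP[].
have notin e1 : e1 \in s -> g a = Some x -> g e1 <> Some x.
  move=> e1s ga ge1; move: u; rewrite ga /= => /andP[/negP nx _].
  by apply: nx; rewrite mem_pmap -ge1 map_f.
case/predU1P=> [->|es] /predU1P[->|e's] // ge ge'; last exact: IHs.
  by case: (notin e').
by case: (notin e).
Qed.

Lemma canonical_ltn : pairwise (fun x y : 'I_n.+1 => x < y) (ord0 :: canonical_cells).
Proof.
rewrite -enum_canonical -[pairwise _ _](pairwise_map val ltn) val_enum_ord.
rewrite -sorted_pairwise //.
  exact: iota_ltn_sorted.
exact: ltn_trans.
Qed.

Definition glue_structure t : fstruct n.+1 :=
  ([ffun x => omap fst (ohead [seq e <- glue_log t | e.2.1 == Some x])],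
   [ffun x => omap fst (ohead [seq e <- glue_log t | e.2.2 == Some x])]).

(** The converse: a complete word with n new cells comes from a constructible structure. Each edge
    is used at most once, so the log defines the gluings unambiguously, and the numbering by
    creation is a construction order. *)
Lemma canonical_presented w (t := label w canonical_cells) :
    complete head_state t -> count isSome w = n ->
  presents (glue_structure t) t /\ ordered_constructible (glue_structure t).
Proof.
move=> co szw; have Nt : new_cells t = canonical_cells.
  by rewrite new_label // size_canonical.
have uV : uniq (ord0 :: new_cells t) by rewrite Nt -enum_canonical enum_uniq.
pose E := glue_log t.
pose S := glue_structure t.
have := uV; rewrite -(perm_uniq (complete_perm1 co)) cat_uniq => /and3P[u1 k1 _].
have := uV; rewrite -(perm_uniq (complete_perm2 co)) cat_uniq => /and3P[u2 k2 _].
have e1 : log (@used1 _) head_state t = pmap (fun e => e.2.1) E by rewrite pmap_log.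
have e2 : log (@used2 _) head_state t = pmap (fun e => e.2.2) E by rewrite pmap_log.
rewrite e1 in u1 k1; rewrite e2 in u2 k2.
have E_inj e e' : e \in E -> e' \in E -> e.1 = e'.1 -> e = e'.
  move=> eE e'E ee'; apply: (@pmap_uniq_inj _ _ (fun e => Some e.1) E e.1) => //.
    have -> : pmap (fun e => Some e.1) E = map fst E by elim: (E) => //= a s ->.
    by rewrite /E glue_new //; case/andP: uV.
  by rewrite ee'.
have S1 x z : S.1 x = Some z <-> exists2 e, e \in E & e.1 = z /\ e.2.1 = Some x.
  rewrite /S /= ffunE -/E; split=> [|[e eE [<- ex]]].
    case Ex: [seq _ <- _ | _] => [|e s] //= [<-].
    have : e \in [seq e <- E | e.2.1 == Some x] by rewrite Ex mem_head.
    by rewrite mem_filter => /andP[/eqP ex eE]; exists e.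
  case Ex: [seq _ <- _ | _] => [|e' s] /=.
    have : e \in [seq e <- E | e.2.1 == Some x] by rewrite mem_filter ex eqxx.
    by rewrite Ex.
  have : e' \in [seq e <- E | e.2.1 == Some x] by rewrite Ex mem_head.
  rewrite mem_filter => /andP[/eqP e'x e'E]; congr Some.
  by rewrite (pmap_uniq_inj u1 eE e'E ex e'x).
have S2 x z : S.2 x = Some z <-> exists2 e, e \in E & e.1 = z /\ e.2.2 = Some x.
  rewrite /S /= ffunE -/E; split=> [|[e eE [<- ex]]].
    case Ex: [seq _ <- _ | _] => [|e s] //= [<-].
    have : e \in [seq e <- E | e.2.2 == Some x] by rewrite Ex mem_head.
    by rewrite mem_filter => /andP[/eqP ex eE]; exists e.
  case Ex: [seq _ <- _ | _] => [|e' s] /=.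
    have : e \in [seq e <- E | e.2.2 == Some x] by rewrite mem_filter ex eqxx.
    by rewrite Ex.
  have : e' \in [seq e <- E | e.2.2 == Some x] by rewrite Ex mem_head.
  rewrite mem_filter => /andP[/eqP e'x e'E]; congr Some.
  by rewrite (pmap_uniq_inj u2 eE e'E ex e'x).
have re : realizes_log S.1 S.2 head_state t.
  split=> [e eE x|x x1|x x2].
  - split; apply/eqP/eqP => [|ex].
    + by case/S1=> e' e'E [ee' <-]; rewrite (E_inj e e').
    + by apply/S1; exists e.
    + by case/S2=> e' e'E [ee' <-]; rewrite (E_inj e e').
    + by apply/S2; exists e.
  - case Sx: (S.1 x) => [z|] //; have /S1[e eE [_ ex]] := Sx.
    case/hasP: k1; exists x => //.
    by rewrite mem_pmap; apply/mapP; exists e.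
  - case Sx: (S.2 x) => [z|] //; have /S2[e eE [_ ex]] := Sx.
    case/hasP: k2; exists x => //.
    by rewrite mem_pmap; apply/mapP; exists e.
have pS : presents S t by split=> //; rewrite Nt -enum_canonical.
split=> //; have va := proj1 (andP co).
have order e x : e \in E -> e.2.1 = Some x \/ e.2.2 = Some x -> x < e.1.
  have /= /andP[lt0 ltN] := canonical_ltn.
  move=> eE ex; apply: (emit_order (lt := fun x y : 'I_n.+1 => x < y) va) eE ex.
    by rewrite Nt /= allrel1l.
  by rewrite Nt.
have order1 x z : S.1 x = Some z -> x < z.
  by case/S1=> e eE [<- ex]; apply: order => //; left.
have order2 x z : S.2 x = Some z -> x < z.
  by case/S2=> e eE [<- ex]; apply: order => //; right.
have col : columns S.1 S.2 head_state by move=> s; rewrite mem_seq1 => /eqP->.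
apply/and4P; split=> //.
- apply/forallP => x; apply/forallP => y; apply/forallP => z.
  apply/implyP => /andP[/eqP/S1[e eE [ez ex]] /eqP/S1[e' e'E [e'z e'y]]].
  have ee' : e = e' by apply: E_inj; rewrite ?ez.
  by move: ex; rewrite ee' e'y => -[->].
- apply/forallP => x; apply/forallP => y; apply/forallP => z.
  apply/implyP => /andP[/eqP/S2[e eE [ez ex]] /eqP/S2[e' e'E [e'z e'y]]].
  have ee' : e = e' by apply: E_inj; rewrite ?ez.
  by move: ex; rewrite ee' e'y => -[->].
apply/forallP => k; case: ifP => k0.
  have {k0}-> : k = ord0 by apply/val_inj/eqP.
  apply/andP; split; apply/existsPn => x; apply/eqP; first by move/order1.
  by move/order2.
have : k \in map fst E.
  by rewrite /E glue_new // (presents_new _ pS); apply: contraFneq k0 => ->.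
case/mapP=> -[z [p q]] eE /= kz; rewrite -{z}kz in eE.
have lu x : S.2 x = Some k -> q = Some x.
  by case/S2=> e' e'E [e'k <-]; rewrite (E_inj _ _ e'E eE).
have ll x : S.1 x = Some k -> p = Some x.
  by case/S1=> e' e'E [e'k <-]; rewrite (E_inj _ _ e'E eE).
have := emit_shape va eE; case: p q ll lu eE => [y|] [x|] //= ll lu eE _.
- have Sy : S.1 y = Some k by apply/S1; exists (k, (Some y, Some x)).
  have Sx : S.2 x = Some k by apply/S2; exists (k, (Some y, Some x)).
  have [a Sa1 Sa2] := emit_above va col re eE.
  apply/or3P/Or33/existsP; exists a; apply/existsP; exists x; apply/existsP; exists y.
  rewrite Sa1 Sa2 Sx Sy !eqxx (order2 _ _ Sx) (order1 _ _ Sy).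
  by rewrite (ltn_trans (order1 _ _ Sa1) (order2 _ _ Sx)).
- have Sy : S.1 y = Some k by apply/S1; exists (k, (Some y, None)).
  apply/or3P/Or31/andP; split; last by apply/existsPn => c; apply/eqP => /lu.
  by apply/existsP; exists y; rewrite Sy eqxx (order1 _ _ Sy).
- have Sx : S.2 x = Some k by apply/S2; exists (k, (None, Some x)).
  apply/or3P/Or32/andP; split; last by apply/existsPn => c; apply/eqP => /ll.
  by apply/existsP; exists x; rewrite Sx eqxx (order2 _ _ Sx).
Qed.

End Presentation.

(** * Counting words *)

(* Words are counted on states over [unit], which only remember column sizes. *)
Definition letter_move (l : option bool) : move unit := omap (pair^~ tt) l.

Fixpoint words f : seq (seq (option bool)) :=
  if f is f'.+1 then
    [::] :: [seq l :: w | l <- [:: None; Some true; Some false], w <- words f']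
  else [::].

Lemma mem_words f w : (w \in words f) = (size w < f).
Proof.
elim: f w => [|f IHf] [|l w] //=; rewrite in_cons /= cats0 !mem_cat ltnS -IHf.
have inj (l' : option bool) : injective (cons l') by move=> u v [].
have cons_mem l' : (l :: w \in map (cons l') (words f)) = (l == l') && (w \in words f).
  apply/mapP/andP=> [[u uW [-> ->]]|[/eqP-> wW]]; first by rewrite eqxx.
  by exists w.
by rewrite !cons_mem {cons_mem}; case: l => [[]|] //=; rewrite ?orbF.
Qed.

Lemma words_uniq f : uniq (words f).
Proof.
elim: f => //= f IHf; rewrite cats0.
have inj (l : option bool) : injective (cons l) by move=> u v [].
have nil_mem l : ([::] \in map (cons l) (words f)) = false by apply/mapP=> -[].
have disj (l l' : option bool) : l != l' -> ~~ has (mem (map (cons l) (words f))) (map (cons l') (words f)).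
  move=> ll'; apply/hasPn => _ /mapP[u _ ->]; apply/negP => /mapP[v _ [e _]].
  by rewrite e eqxx in ll'.
rewrite !mem_cat !nil_mem !cat_uniq !map_inj_uniq //= IHf /= has_cat.
by rewrite !negb_or !disj.
Qed.

(** Here i leaves out the free left lower edge of the head. *)
Definition admissible (st : state unit) i j w :=
  let t := map letter_move w in
  [&& complete st t, size (log (@open_left _) st t) == i
    & size (log (@skip2 _) st t) == j].

Definition word_count st i j f : nat :=
  \sum_(w <- words f) admissible st i j w.

Definition tail_count st i j f : nat :=
  \sum_(w <- words f)
    admissible st i j w * size (log (@tail_cell _) st (map letter_move w)).

Lemma big_wordsS f (F : seq (option bool) -> nat) :
  \sum_(w <- words f.+1) F w = F [::] + (\sum_(w <- words f) F (None :: w)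
    + (\sum_(w <- words f) F (Some true :: w)
       + \sum_(w <- words f) F (Some false :: w))).
Proof. by rewrite /= cats0 big_cons !big_cat !big_map. Qed.

Section Recurrences.
Variables (i j f : nat) (stk : seq (seq unit)).

Lemma word_count_nil :
  word_count (Idle [::]) i j f.+1 = (i == 0) && (j == 0).
Proof.
rewrite /word_count big_wordsS !big1 // !addn0.
by rewrite /admissible /= !(eq_sym 0).
Qed.

Lemma tail_count_nil : tail_count (Idle [::]) i j f.+1 = 0.
Proof. by rewrite /tail_count big_wordsS !big1 // muln0. Qed.

Lemma word_count_pop :
  word_count (Idle ([::] :: stk)) i j f.+1 = word_count (Idle stk) i j f.
Proof.
by rewrite /word_count big_wordsS [X in _ + (_ + (X + _))]big1 //
  [X in _ + (_ + (_ + X))]big1 // !addn0 add0n.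
Qed.

Lemma tail_count_pop :
  tail_count (Idle ([::] :: stk)) i j f.+1 = tail_count (Idle stk) i j f.
Proof.
by rewrite /tail_count big_wordsS [X in _ + (_ + (X + _))]big1 //
  [X in _ + (_ + (_ + X))]big1 // !addn0 add0n.
Qed.

Lemma word_count_start x xs : word_count (Idle ((x :: xs) :: stk)) i j f.+1 =
  word_count (Busy [::] x xs stk) i j f + word_count (Busy [:: tt] x xs stk) i j f.
Proof.
by rewrite /word_count big_wordsS [X in _ + (_ + (_ + X))]big1 // addn0 add0n.
Qed.

Lemma tail_count_start x xs : tail_count (Idle ((x :: xs) :: stk)) i j f.+1 =
  tail_count (Busy [::] x xs stk) i j f + tail_count (Busy [:: tt] x xs stk) i j f.
Proof.
by rewrite /tail_count big_wordsS [X in _ + (_ + (_ + X))]big1 // addn0 add0n.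
Qed.

(** The terms stand for the three letters: a free right lower edge, a new cell with a free left
    lower edge, and a cell glued by operation (iii). *)
Lemma word_count_busy out x xs : word_count (Busy out x xs stk) i j f.+1 =
  (if j is j'.+1 then word_count (Idle (out :: xs :: stk)) i j' f else 0)
  + ((if i is i'.+1 then word_count (Idle (rcons out tt :: xs :: stk)) i' j f else 0)
  + (if xs is y :: ys then word_count (Busy (rcons out tt) y ys stk) i j f else 0)).
Proof.
rewrite /word_count big_wordsS add0n; congr (_ + (_ + _)).
- rewrite /admissible /=; case: xs => [|y ys] /=;
    by case: j => [|j'] //; rewrite big1 // => w _; rewrite !andbF.
- rewrite /admissible /=; case: xs => [|y ys] /=;
    by case: i => [|i'] //; rewrite big1 // => w _; rewrite !andbF.
- by case: xs => [|y ys] //; rewrite big1.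
Qed.

Lemma tail_count_busy out x xs : tail_count (Busy out x xs stk) i j f.+1 =
  (if j is j'.+1 then nilp out * word_count (Idle (out :: xs :: stk)) i j' f
     + tail_count (Idle (out :: xs :: stk)) i j' f else 0)
  + ((if i is i'.+1 then tail_count (Idle (rcons out tt :: xs :: stk)) i' j f else 0)
  + (if xs is y :: ys then tail_count (Busy (rcons out tt) y ys stk) i j f else 0)).
Proof.
rewrite /tail_count big_wordsS add0n; congr (_ + (_ + _)).
- case: j => [|j'].
    by rewrite big1 // => w _; rewrite /admissible /= !andbF.
  rewrite /word_count big_distrr -big_split; apply: eq_bigr => w _.
  by rewrite /admissible /= size_cat mulnDr mulnC; case: out; case: xs.
- rewrite /admissible /=; case: xs => [|y ys] /=;
    by case: i => [|i'] //; rewrite big1 // => w _; rewrite !andbF.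
- by case: xs => [|y ys] //; rewrite big1.
Qed.

End Recurrences.

(** * Word counts as coefficients of the column series *)

Section GeneratingSeries.
Local Open Scope ring_scope.

(** Counts range over words of bounded length; the coefficients are their eventual values as the
    bound grows. *)
Definition stabilizes (u : nat -> nat) (v : rat) :=
  exists F, forall f, (F <= f)%N -> (u f)%:R = v.

Lemma stabilizesD u u' v v' : stabilizes u v -> stabilizes u' v' ->
  stabilizes (fun f => u f + u' f)%N (v + v').
Proof.
move=> [F uF] [F' uF']; exists (maxn F F') => f; rewrite geq_max => /andP[H H'].
by rewrite natrD uF ?uF'.
Qed.

Lemma stabilizesM c u v : stabilizes u v -> stabilizes (fun f => c * u f)%N (c%:R * v).
Proof. by move=> [F uF]; exists F => f /uF E; rewrite natrM E. Qed.

Lemma stabilizesS u v : stabilizes (fun f => u f.+1) v -> stabilizes u v.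
Proof. by move=> [F uF]; exists F.+1 => -[|f] // /uF. Qed.

Lemma eq_stabilizes u u' v v' : (forall f, u f = u' f) -> v = v' ->
  stabilizes u v -> stabilizes u' v'.
Proof. by move=> uu' <- [F uF]; exists F => f /uF; rewrite uu'. Qed.

Lemma stabilizes_cst n : stabilizes (fun=> n) n%:R.
Proof. by exists 0%N. Qed.

Variables C G : nat -> bps rat.
Local Notation a := (bpsX rat).
Local Notation b := (bpsY rat).

Hypothesis C0 : C 0%N = 1.
Hypothesis G0 : G 0%N = 0.
Hypothesis CS : forall n, C n.+1 =
  \sum_(m < n.+1) closing_weight a b C m * C (n - m)%N.
Hypothesis GS : forall n, G n.+1 = \sum_(m < n.+1)
  ((closing_weight a b G m + b * (val m == 0%N)%:R) * C (n - m)%N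
   + closing_weight a b C m * G (n - m)%N).

Definition stack_series (stk : seq (seq unit)) : bps rat :=
  \prod_(s <- stk) C (size s).

Fixpoint stack_tails (stk : seq (seq unit)) : bps rat :=
  if stk is s :: stk' then
    G (size s) * stack_series stk' + C (size s) * stack_tails stk'
  else 0.

(* The [(k == 0)] in [close_tails] accounts for the tail created when a segment
   ends without any new cell. *)
Definition close_series k := a * C k.+1 + b * C k.
Definition close_tails k := a * G k.+1 + b * (G k + (k == 0%N)%:R).

(** With k cells in [out] and r cells below the current one, m is the number of those r cells that
    still join the segment; the other r - m form a column explored afterwards. *)
Definition busy_series k r := \sum_(m < r.+1) close_series (k + m) * C (r - m)%N.
Definition busy_tails k r := \sum_(m < r.+1)
  (close_tails (k + m) * C (r - m)%N + close_series (k + m) * G (r - m)%N).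

Definition state_series (st : state unit) : bps rat :=
  match st with
  | Idle stk => stack_series stk
  | Busy out _ xs stk => busy_series (size out) (size xs) * stack_series stk
  end.

Definition state_tails (st : state unit) : bps rat :=
  match st with
  | Idle stk => stack_tails stk
  | Busy out _ xs stk => busy_tails (size out) (size xs) * stack_series stk
                     + busy_series (size out) (size xs) * stack_tails stk
  end.

Lemma busy_series0 k : busy_series k 0 = close_series k * C 0%N.
Proof. by rewrite /busy_series big_ord1 addn0 subn0. Qed.

Lemma busy_seriesS k r :
  busy_series k r.+1 = close_series k * C r.+1 + busy_series k.+1 r.
Proof.
rewrite /busy_series big_ord_recl addn0 subn0; congr (_ + _).
by apply: eq_bigr => m _; rewrite lift0 subSS addSnnS.
Qed.

Lemma busy_tails0 k :
  busy_tails k 0 = close_tails k * C 0%N + close_series k * G 0%N.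
Proof. by rewrite /busy_tails big_ord1 addn0 subn0. Qed.

Lemma busy_tailsS k r : busy_tails k r.+1 =
  close_tails k * C r.+1 + close_series k * G r.+1 + busy_tails k.+1 r.
Proof.
rewrite /busy_tails big_ord_recl addn0 subn0; congr (_ + _).
by apply: eq_bigr => m _; rewrite lift0 subSS addSnnS.
Qed.

Lemma column_series r : C r.+1 = busy_series 0 r + busy_series 1 r.
Proof.
rewrite CS /busy_series -big_split; apply: eq_bigr => m _ /=.
by rewrite add0n add1n /close_series /closing_weight; ring.
Qed.

Lemma column_tails r : G r.+1 = busy_tails 0 r + busy_tails 1 r.
Proof.
rewrite GS /busy_tails -big_split; apply: eq_bigr => m _ /=.
by rewrite add0n add1n /close_series /close_tails /closing_weight mulr0n; ring.
Qed.

(** It only has to decrease for the letters that cost neither a nor b: dropping a column, starting a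
    segment, continuing it. *)
Definition state_measure (st : state unit) : nat :=
  match st with
  | Idle stk => (size stk + size (flatten stk))%N
  | Busy _ _ xs _ => size xs
  end.

(** Induction on i + j, then on [state_measure]: closing a segment may create large columns, but it
    lowers i or j. *)
Theorem state_counts st i j :
  stabilizes (word_count st i j) (state_series st i j) /\
  stabilizes (tail_count st i j) (state_tails st i j).
Proof.
have [N] := ubnP (i + j); elim: N st i j => // N IHN st i j ltN.
have [M] := ubnP (state_measure st); elim: M st => // M IHM st ltM.
case: st ltM => [[|[|x xs] stk]|out x xs stk] ltM.
- split; apply: stabilizesS.
    apply: eq_stabilizes (stabilizes_cst ((i == 0%N) && (j == 0%N))) => [f|].
      by rewrite word_count_nil.
    by rewrite /= /stack_series big_nil bps_1E.
  apply: eq_stabilizes (stabilizes_cst 0) => [f|]; first by rewrite tail_count_nil.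
  by rewrite /= !fps_0E.
- have [|H H'] := IHM (Idle stk); first by rewrite /= in ltM *; lia.
  split; apply: stabilizesS.
    apply: eq_stabilizes H => [f|]; first by rewrite word_count_pop.
    by rewrite /= /stack_series big_cons C0 mul1r.
  apply: eq_stabilizes H' => [f|]; first by rewrite tail_count_pop.
  by rewrite /= C0 G0 mul0r add0r mul1r.
- have [|H0 H0'] := IHM (Busy [::] x xs stk).
    by rewrite /= size_cat in ltM *; lia.
  have [|H1 H1'] := IHM (Busy [:: tt] x xs stk).
    by rewrite /= size_cat in ltM *; lia.
  split; apply: stabilizesS.
    apply: eq_stabilizes (stabilizesD H0 H1) => [f|].
      by rewrite word_count_start.
    rewrite /= /stack_series big_cons column_series -bps_addE.
    by congr ((_ : bps rat) i j); ring.
  apply: eq_stabilizes (stabilizesD H0' H1') => [f|].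
    by rewrite tail_count_start.
  rewrite /= column_series column_tails -bps_addE.
  by congr ((_ : bps rat) i j); ring.
have HF : stabilizes (fun f => if j is j'.+1
      then word_count (Idle (out :: xs :: stk)) i j' f else 0%N)
    ((b * state_series (Idle (out :: xs :: stk))) i j) /\
  stabilizes (fun f => if j is j'.+1
      then (nilp out * word_count (Idle (out :: xs :: stk)) i j' f
            + tail_count (Idle (out :: xs :: stk)) i j' f)%N else 0%N)
    ((b * ((nilp out)%:R * state_series (Idle (out :: xs :: stk))
           + state_tails (Idle (out :: xs :: stk)))) i j).
  rewrite !bpsYM; case: (j) ltN => [|j'] ltN.
    by split; apply: stabilizes_cst.
  have [|H H'] := IHN (Idle (out :: xs :: stk)) i j'; first by lia.
  split=> //; apply: stabilizesD H'; apply: eq_stabilizes (stabilizesM (nilp out) H) => //.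
  by case: nilp; rewrite ?mul1r // !mul0r !fps_0E.
have HE : stabilizes (fun f => if i is i'.+1
      then word_count (Idle (rcons out tt :: xs :: stk)) i' j f else 0%N)
    ((a * state_series (Idle (rcons out tt :: xs :: stk))) i j) /\
  stabilizes (fun f => if i is i'.+1
      then tail_count (Idle (rcons out tt :: xs :: stk)) i' j f else 0%N)
    ((a * state_tails (Idle (rcons out tt :: xs :: stk))) i j).
  rewrite !bpsXM; case: (i) ltN => [|i'] ltN.
    by split; apply: stabilizes_cst.
  by apply: IHN; lia.
have HJ : stabilizes (fun f => if xs is y :: ys
      then word_count (Busy (rcons out tt) y ys stk) i j f else 0%N)
    ((if xs is y :: ys then state_series (Busy (rcons out tt) y ys stk) else 0) i j) /\
  stabilizes (fun f => if xs is y :: ys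
      then tail_count (Busy (rcons out tt) y ys stk) i j f else 0%N)
    ((if xs is y :: ys then state_tails (Busy (rcons out tt) y ys stk) else 0) i j).
  case: (xs) ltM => [|y ys] ltM; last by apply: IHM; rewrite /= in ltM *; lia.
  by rewrite !fps_0E; split; apply: stabilizes_cst.
case: HF HE HJ => [HF HF'] [HE HE'] [HJ HJ']; split; apply: stabilizesS.
  apply: eq_stabilizes (stabilizesD HF (stabilizesD HE HJ)) => [f|].
    by rewrite word_count_busy.
  rewrite -!bps_addE; congr ((_ : bps rat) i j).
  rewrite /= /stack_series !big_cons size_rcons /=.
  case: (xs) => [|y ys] /=; rewrite ?busy_series0 ?busy_seriesS ?size_rcons
    /close_series; ring.
apply: eq_stabilizes (stabilizesD HF' (stabilizesD HE' HJ')) => [f|].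
  by rewrite tail_count_busy.
rewrite -!bps_addE; congr ((_ : bps rat) i j).
have nilC : (size out == 0%N)%:R * C (size out) = (size out == 0%N)%:R.
  by case: (size out) => [|k]; rewrite ?C0 ?mulr1 // mulr0n mul0r.
rewrite /= /stack_series !big_cons size_rcons /=.
case: (xs) => [|y ys] /=; rewrite ?(busy_series0, busy_tails0, busy_seriesS, busy_tailsS)
  ?size_rcons /close_series /close_tails /nilp; ring: nilC.
Qed.

End GeneratingSeries.

(** * Fish with a marked tail as words *)

Definition head_shape : state unit := Idle [:: [:: tt]].

Section Words.
Variable n : nat.

Lemma shape_moves (t : seq (move 'I_n.+1)) :
  map (map_move (fun=> tt)) t = map letter_move (word t).
Proof. by rewrite /word -map_comp; apply: eq_map => -[[b z]|]. Qed.

Lemma admissible_word i j (t : seq (move 'I_n.+1)) :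
  admissible head_shape i j (word t) =
    [&& complete (head_state n) t,
        size (log (@open_left _) (head_state n) t) == i
      & size (skip2_log t) == j].
Proof.
rewrite /admissible -shape_moves.
have -> : head_shape = map_state (fun=> tt) (head_state n) by [].
rewrite map_complete (map_log_natural (map_open_left _)).
by rewrite (map_log_natural (map_skip2 _)) !size_map.
Qed.

Lemma size_tails_word (t : seq (move 'I_n.+1)) :
  size (log (@tail_cell _) head_shape (map letter_move (word t))) =
  size (log (@tail_cell _) (head_state n) t).
Proof.
rewrite -shape_moves.
have -> : head_shape = map_state (fun=> tt) (head_state n) by [].
by rewrite (map_log_natural (map_tail_cell _)) size_map.
Qed.

Lemma relabel1 (S : fstruct n.+1) : relabel 1%g S = S.
Proof.
case: S => S1 S2; congr pair; apply/ffunP => x; rewrite ffunE invg1 perm1 /=.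
  by case: (S1 x) => //= y; rewrite perm1.
by case: (S2 x) => //= y; rewrite perm1.
Qed.

Lemma relabelM (s r : {perm 'I_n.+1}) (S : fstruct n.+1) :
  relabel r (relabel s S) = relabel (s * r)%g S.
Proof.
case: S => S1 S2; congr pair; apply/ffunP => x; rewrite !ffunE /= ?ffunE invMg permM.
  by case: (S1 _) => //= y; rewrite permM.
by case: (S2 _) => //= y; rewrite permM.
Qed.

Lemma pair_class_id (p : fstruct n.+1 * 'I_n.+1) : p \in pair_class p.
Proof.
by apply/imsetP; exists 1%g => //; rewrite relabel1 perm1; case: p.
Qed.

Lemma pair_class_relabel s (S : fstruct n.+1) x :
  pair_class (relabel s S, s x) = pair_class (S, x).
Proof.
apply/setP => p; apply/imsetP/imsetP => -[r _ ->] /=.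
  by exists (s * r)%g => //; rewrite relabelM permM.
exists (s^-1 * r)%g => //; rewrite relabelM permM permK mulgA.
by rewrite mulgV mul1g.
Qed.

Lemma presents_parent S t (z : 'I_n.+1) : presents S t ->
  z != ord0 <-> exists x, S.1 x = Some z \/ S.2 x = Some z.
Proof.
move=> pS; have [co _ _] := pS; rewrite -(presents_new _ pS) -glue_new //.
split=> [/mapP[e e_t ->]|[x [|]]].
- have := emit_shape (proj1 (andP co)) e_t; case: e e_t => z' [[x|] [y|]] //= e_t _.
  + by exists x; left; apply/(presents_glue1 _ _ pS); exists (z', (Some x, Some y)).
  + by exists x; left; apply/(presents_glue1 _ _ pS); exists (z', (Some x, None)).
  + by exists y; right; apply/(presents_glue2 _ _ pS); exists (z', (None, Some y)).
- by case/(presents_glue1 _ _ pS)=> e e_t [<- _]; apply: map_f.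
- by case/(presents_glue2 _ _ pS)=> e e_t [<- _]; apply: map_f.
Qed.

Lemma final_cell_relabel s (S : fstruct n.+1) x :
  final_cell (relabel s S) (s x) = final_cell S x.
Proof. by rewrite /final_cell !relabelE; case: (S.1 x); case: (S.2 x). Qed.

Variables (i j F : nat).
Hypothesis F_bound : forall w, admissible head_shape i j w -> size w < F.

Definition fish_words :=
  [seq w <- words F | admissible head_shape i j w && (count isSome w == n)].

Definition word_trace w : seq (move 'I_n.+1) := label w (canonical_cells n).

Definition tail_pairs := [seq pair_class (glue_structure (word_trace w), x) |
  w <- fish_words, x <- log (@tail_cell _) (head_state n) (word_trace w)].

Lemma fish_wordsP w : w \in fish_words ->
  [/\ word (word_trace w) = w /\ new_cells (word_trace w) = canonical_cells n,
      presents (glue_structure (word_trace w)) (word_trace w),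
      ordered_constructible (glue_structure (word_trace w)),
      n_free_ll (glue_structure (word_trace w)) = i.+1
    & n_free_rl (glue_structure (word_trace w)) = j].
Proof.
rewrite mem_filter => /andP[/andP[adm /eqP cw] _].
have ww : word (word_trace w) = w by rewrite word_label // size_canonical.
have := adm; rewrite -{1}ww admissible_word => /and3P[co /eqP El /eqP Er].
have [pS oc] := canonical_presented co cw; split=> //.
- by split=> //; rewrite new_label // size_canonical.
  by rewrite (presents_free_ll pS) El.
- by rewrite (presents_free_rl pS) Er.
Qed.

(** A relabelling between two canonical structures fixes the head, hence carries one trace to the
    other; as both create the cells in the same order, it is the identity. In particular a fish has
    no symmetry that could identify two of its tails. *)
Lemma tail_pairs_uniq : uniq tail_pairs.
Proof.
apply: allpairs_uniq_dep => [|w wW|].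
- by rewrite filter_uniq ?words_uniq.
- by have [_ pS _ _ _] := fish_wordsP wW; apply: tails_uniq pS.
move=> _ _ /allpairsPdep[w [x [wW x_t ->]]] /allpairsPdep[w' [x' [wW' x_t' ->]]] /=.
set S := glue_structure _; set S' := glue_structure _ => E.
have [[ww Nw] pS _ _ _] := fish_wordsP wW.
have [[ww' _] pS' _ _ _] := fish_wordsP wW'.
have /imsetP[s _ Esx] : (S', x') \in pair_class (S, x).
  by rewrite E pair_class_id.
have ES : S' = relabel s S := congr1 fst Esx.
have Ex : x' = s x := congr1 snd Esx.
(* The head is the only cell without a left neighbour, a property invariant under relabelling. *)
have s0 : s ord0 = ord0.
  apply/eqP; apply/negPn/negP => /(presents_parent _ pS')[y].
  rewrite -/S' ES -[y](permKV s) !relabelE; set y0 := (_ y) => Sy.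
  suff: ord0 != ord0 :> 'I_n.+1 by rewrite eqxx.
  apply/(presents_parent _ pS); exists y0.
  by case: Sy; [case: (S.1 y0) => //= z [/perm_inj->]; left
               | case: (S.2 y0) => //= z [/perm_inj->]; right].
have := presents_relabel s0 pS; rewrite -ES => pS''.
pose N := maxn (size (word_trace w')) (size (word_trace w)).
have Et : word_trace w' = map (map_move s) (word_trace w).
  rewrite -(presents_explore (fuel := N) pS') ?leq_maxl //.
  by rewrite (presents_explore pS'') // size_map leq_maxr.
have ew : w' = w by rewrite -ww -ww' Et word_map.
have s_id y : s y = y.
  have [->//|y0] := eqVneq y ord0.
  have y_can : y \in canonical_cells n by rewrite -Nw (presents_new _ pS).
  rewrite ew in Et; have := congr1 (@new_cells _) Et.
  rewrite map_new_cells Nw -[in LHS](map_id (canonical_cells n)).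
  by move/eq_in_map=> /(_ _ y_can).
by rewrite ew Ex s_id.
Qed.

Lemma mem_tail_pairs : fish_tail_classes n.+1 i.+1 j =i tail_pairs.
Proof.
move=> P; apply/imsetP/allpairsPdep => [[[S x]]|[w [x [wW x_t ->]]]].
  rewrite inE /= => /and4P[oc fin /eqP El /eqP Er] ->.
  have [t pS] := ordered_constructible_presented oc.
  have [s s0 pS'] := presents_canonical pS.
  have [co _ _] := pS.
  have cw : count isSome (word t) = n.
    rewrite count_word; have [_ _ /perm_size] := pS.
    by rewrite size_enum_ord => -[].
  have adm : admissible head_shape i j (word t).
    rewrite admissible_word co -(presents_free_rl pS) Er eqxx andbT.
    by apply/eqP/succn_inj; rewrite -(presents_free_ll pS).
  have wW : word t \in fish_words.
    by rewrite mem_filter adm cw eqxx mem_words F_bound.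
  have [_ pS'' _ _ _] := fish_wordsP wW.
  exists (word t), (s x); split=> //.
    by rewrite (presents_final _ pS') final_cell_relabel.
  by rewrite -(presents_functional pS' pS'') pair_class_relabel.
have [_ pS oc El Er] := fish_wordsP wW.
exists (glue_structure (word_trace w), x) => //.
by rewrite inE /= oc El Er !eqxx -(presents_final _ pS) x_t.
Qed.

Lemma fish_tail_count_words : fish_tail_count n.+1 i.+1 j =
  \sum_(w <- words F | admissible head_shape i j w && (count isSome w == n))
     size (log (@tail_cell _) head_shape (map letter_move w)).
Proof.
rewrite /fish_tail_count (eq_card mem_tail_pairs) (card_uniqP tail_pairs_uniq).
rewrite size_allpairs_dep sumnE big_map -[RHS]big_filter -/fish_words.
apply: eq_big_seq => w /fish_wordsP[[ww _] _ _ _ _].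
by rewrite -{2}ww size_tails_word.
Qed.

End Words.

(** * Summation over the number of cells and the closed formula *)

Lemma fish_tail_count0 i j : fish_tail_count 0 i j = 0.
Proof.
rewrite /fish_tail_count; apply/eqP; rewrite cards_eq0; apply/eqP/setP => P.
by rewrite inE; apply/negP => /imsetP[[S []]].
Qed.

(** A word determines its number n of new cells, and the fish has n + 1 cells with the head, at most
    [F] as the word has fewer than [F] letters. *)
Lemma sum_fish_tail_count i j F :
    (forall w, admissible head_shape i j w -> size w < F) ->
  (forall n, F < n -> fish_tail_count n i.+1 j = 0)
  /\ \sum_(n < F.+1) fish_tail_count n i.+1 j = tail_count head_shape i j F.
Proof.
move=> F_bound; split=> [[|n] // ltFn|].
  rewrite (fish_tail_count_words n F_bound) big_seq_cond big1 // => w.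
  rewrite mem_words => /and3P[ltw _ /eqP cw].
  by have := leq_ltn_trans (count_size isSome w) ltw; rewrite cw ltnNge -ltnS ltFn.
rewrite big_ord_recl fish_tail_count0 add0n.
under eq_bigr => n _ do rewrite /= (fish_tail_count_words n F_bound) big_mkcond.
rewrite exchange_big /tail_count big_seq [RHS]big_seq; apply: eq_bigr => w.
rewrite mem_words => ltw; have cw := leq_ltn_trans (count_size isSome w) ltw.
rewrite (bigD1 (Ordinal cw)) //= eqxx andbT big1 ?addn0 => [|n neq].
  by case: ifP; rewrite ?mul1n.
by case: eqP => //= [E|]; rewrite ?andbF //; case/eqP: neq; apply: val_inj.
Qed.

(** An admissible word of length at least [F] would raise the count once longer words are
    allowed. *)
Lemma admissible_bound i j F c :
    (forall f, F <= f -> word_count head_shape i j f = c) ->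
  forall w, admissible head_shape i j w -> size w < F.
Proof.
move=> stab w adm; rewrite ltnNge; apply/negP => leFw.
pose L f := [seq w <- words f | admissible head_shape i j w].
have sizeL f : F <= f -> size (L f) = c.
  by move=> /stab <-; rewrite /word_count size_filter -sum1_count big_mkcond.
have sub : {subset L F <= L (size w).+1}.
  move=> u; rewrite !mem_filter !mem_words => /andP[-> ltu].
  by rewrite (leq_trans ltu) // leqW.
have [_ eqL] := uniq_min_size (filter_uniq _ (words_uniq F)) sub
  (eq_leq (etrans (sizeL _ (leqW leFw)) (esym (sizeL _ (leqnn F))))).
have : w \in L F by rewrite eqL mem_filter adm mem_words /= ltnS.
by rewrite mem_filter mem_words ltnNge leFw andbF.
Qed.

Theorem theorem3 (i j : nat) (hi : (1 <= i)%N) (hj : (1 <= j)%N) :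
  exists N : nat,
    (forall n : nat, (N <= n)%N -> fish_tail_count n i j = 0%N) /\
    ((\sum_(n < N) fish_tail_count n i j)%N%:R =
      ((2 * i + 2 * j - 3)%N%:R / ((2 * i - 1) * (2 * j - 1))%N%:R)
      * ('C(2 * i + j - 3, j - 1))%:R * ('C(2 * j + i - 3, i - 1))%:R :> rat)%R.
Proof.
case: i j hi hj => // n [//|m] _ _.
have [al [be [alE beE]]] := bps_system rat.
have [C [G [C0 G0 G1 CS GS]]] := column_equations_solution alE beE.
have [[F1 stab1] [F2 stab2]] := state_counts C0 G0 CS GS head_shape n m.+1.
pose F := maxn F1 F2.
have bound : forall w, admissible head_shape n m.+1 w -> size w < F.
  apply: (@admissible_bound _ _ _ (word_count head_shape n m.+1 F)) => f leFf.
  apply/eqP; rewrite -(eqr_nat rat) !stab1 ?leq_maxl //.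
  exact: leq_trans (leq_maxl _ _) leFf.
have [zero sumE] := sum_fish_tail_count bound.
exists F.+1; split=> //; rewrite sumE stab2 ?leq_maxr //=.
(* The head is a column of one cell, so the series is G_1 = b (1 + al) (1 + be); the factor b lowers
   m + 1 to m, and the head's own free left lower edge is why n stands for i - 1. *)
rewrite G1 /stack_series big_nil mulr1 mulr0 addr0 bpsYM.
have := good_lagrange alE beE 0 0 n m; rewrite !expr1 => ->.
rewrite /good_coef !addn0.
have -> : (m.+1 - 1 = m)%N by rewrite subn1.
have -> : (n.+1 - 1 = n)%N by rewrite subn1.
rewrite (_ : 2 * n.+1 + 2 * m.+1 - 3 = 2 * n + 2 * m + 1)%N; last by lia.
rewrite (_ : 2 * n.+1 + m.+1 - 3 = 2 * n + m)%N; last by lia.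
rewrite (_ : 2 * m.+1 + n.+1 - 3 = n + 2 * m)%N; last by lia.
rewrite (_ : 2 * n.+1 - 1 = 2 * n + 1)%N; last by lia.
rewrite (_ : 2 * m.+1 - 1 = 2 * m + 1)%N; last by lia.
move: ('C(_, _)) ('C(_, _)) => u v.
rewrite natrM !(natrD _ _ 1) (natrD _ (2 * n)%N) !natrM.
field; rewrite -!natrM !natr1 ?nat1r !pnatr_eq0; lia.
Qed.
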